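(* Let $\Omega\subset\mathbb{R}^n$ be a bounded domain with $C^2$ boundary. For $\tau>0$ let $X_\tau$ be $L^2(\Omega)\times L^2(\partial\Omega)$ with inner product $(w,v)_{X_\tau}=\int_\Omega w_1v_1+\tau\int_{\partial\Omega}w_2v_2$, and let $\mathcal{E}_\tau\colon X_\tau\to[0,\infty]$ be $\mathcal{E}_\tau(w_1,w_2)=|Dw_1|(\Omega)+\int_{\partial\Omega}|\gamma w_1-w_2|$ if $w_1\in BV(\Omega)$ and $+\infty$ otherwise, where $\gamma\colon BV(\Omega)\to L^1(\partial\Omega)$ is the trace operator. Let $X_\infty=L^2(\Omega)$ and let $\mathcal{E}_\infty\colon X_\infty\to[0,\infty]$ be $\mathcal{E}_\infty(w)=|Dw|(\Omega)+\int_{\partial\Omega}|\gamma w|$ if $w\in BV(\Omega)$ and $+\infty$ otherwise. Let $L_\tau\colon X_\tau\to X_\infty$, $L_\tau(w_1,w_2)=w_1$. Let $S_\tau$, $S_\infty$ be the gradient flows of $\mathcal{E}_\tau$, $\mathcal{E}_\infty$. Then $S_\tau$ uniformly converges to $S_\infty$ along $L_\tau$ as $\tau\to\infty$.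
   Context: $|Dw|(\Omega)$ is the total variation of $w$ in $\Omega$. Strong convergence along $L_\tau$ (as $\tau\to\infty$): for $w\in X_\infty$, $w^\tau\in X_\tau$, $w^\tau$ converge strongly to $w$ along $L_\tau$ if $\|w^\tau\|_{X_\tau}\to\|w\|_{X_\infty}$ and $L_\tau w^\tau\to w$ in $X_\infty$. Gradient flow: for a convex, lower semicontinuous $\mathcal{E}\colon X\to[0,\infty]$ on a Hilbert space $X$, with $D(\mathcal{E})=\{\mathcal{E}<\infty\}$, for every $u_0\in\overline{D(\mathcal{E})}$ and $T>0$ there is exactly one $u\in C([0,T],X)\cap W^{1,1}_{loc}(]0,T],X)$ with $u_t\in-\partial\mathcal{E}(u)$ for a.e. $t\in]0,T[$ and $u(0)=u_0$; the map $S\colon u_0\mapsto u$ is the gradient flow of $\mathcal{E}$ (the subdifferential is taken with respect to the inner product of $X$). Uniform convergence of flows: $S_\tau$ uniformly converges to $S_\infty$ along $L_\tau$ as $\tau\to\infty$ if (for every $T>0$) $L_\tau S_\tau u_0^\tau\to S_\infty u_0$ in $C([0,T],X_\infty)$ and $\|S_\tau u_0^\tau\|_{X_\tau}\to\|S_\infty u_0\|_{X_\infty}$ in $C([0,T])$ whenever $u_0\in\overline{D(\mathcal{E}_\infty)}$, $u_0^\tau\in\overline{D(\mathcal{E}_\tau)}$ and $u_0^\tau$ converge strongly to $u_0$ along $L_\tau$. *)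

(* Defs.v *)
From HB Require Import structures.
From mathcomp Require Import all_boot all_order all_algebra.
From mathcomp Require Import all_classical all_reals all_analysis.

Set Implicit Arguments.
Unset Strict Implicit.
Unset Printing Implicit Defensive.

Import Order.TTheory GRing.Theory Num.Theory.
Import numFieldNormedType.Exports.

Local Open Scope classical_set_scope.
Local Open Scope ring_scope.

Section outer_measures_from_covers.
Variables (R : realType) (T : pointedType).
Local Open Scope ereal_scope.

Definition cover_outer (zeta : set T -> \bar R) (X : set T) : \bar R :=
  ereal_inf [set \sum_(k <oo) zeta (A k) |
             A in [set A : (set T)^nat | X `<=` \bigcup_k A k]].

(* A copy of T in which every set is measurable, so that mathcomp's [mu_ext]
   applies to arbitrary covers. *)
Definition all_sets : Type := T.
HB.instance Definition _ := Pointed.on all_sets.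
HB.instance Definition _ := @isMeasurable.Build default_measure_display
  all_sets [set: set all_sets] I (fun _ _ => I) (fun _ _ => I).

Lemma cover_outerE zeta : cover_outer zeta = mu_ext (zeta : set all_sets -> _).
Proof.
apply/funext => X; rewrite /cover_outer /mu_ext /measurable_cover.
congr (ereal_inf (image _ _)); apply/seteqP; split => A /=.
- by move=> XA; split.
- by case.
Qed.

Section cover_outer_measure.
Variable zeta : set T -> \bar R.
Hypotheses (zeta0 : zeta set0 = 0) (zeta_ge0 : forall A, 0 <= zeta A).

Lemma cover_outer0 : cover_outer zeta set0 = 0.
Proof. by rewrite cover_outerE; apply: mu_ext0. Qed.

Lemma cover_outer_ge0 X : 0 <= cover_outer zeta X.
Proof. by rewrite cover_outerE; apply: mu_ext_ge0. Qed.

Lemma le_cover_outer : {homo cover_outer zeta : A B / A `<=` B >-> A <= B}.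
Proof.
move=> A B AB; apply/ereal_inf_le_tmp => _ [F BF <-].
by exists F => //; apply: subset_trans BF.
Qed.

Lemma cover_outer_sigma_subadditive : sigma_subadditive (cover_outer zeta).
Proof. by rewrite cover_outerE; exact: (@mu_ext_sigma_subadditive _ all_sets R zeta zeta_ge0). Qed.

End cover_outer_measure.

Section restriction.
Variable mu : {outer_measure set T -> \bar R}.

(* If D is mu-measurable, the Caratheodory-measurable sets of the restriction
   are the sets whose trace on D is mu-measurable; integrating against the
   restriction is thus integrating over D against mu. *)
Definition restr_outer (D X : set T) : \bar R := mu (X `&` D).

Variable D : set T.

Let restr0 : restr_outer D set0 = 0.
Proof. by rewrite /restr_outer set0I outer_measure0. Qed.

Let restr_ge0 X : 0 <= restr_outer D X.
Proof. exact: outer_measure_ge0. Qed.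

Let le_restr : {homo restr_outer D : A B / A `<=` B >-> A <= B}.
Proof. by move=> A B AB; apply: le_outer_measure; apply: setSI. Qed.

Let restr_subadditive : sigma_subadditive (restr_outer D).
Proof.
by move=> F; rewrite /restr_outer setI_bigcupl;
  apply: outer_measure_sigma_subadditive.
Qed.

HB.instance Definition _ := isOuterMeasure.Build R T (restr_outer D)
  restr0 restr_ge0 le_restr restr_subadditive.

End restriction.
End outer_measures_from_covers.

Section euclidean.
Variables (R : realType) (n : nat).
Implicit Types (x y a b : 'rV[R]_n) (E : set 'rV[R]_n).

(* The library norm on row vectors is the sup norm. *)
Definition enorm x : R := Num.sqrt (\sum_i x 0 i ^+ 2).

Definition eball x (r : R) : set 'rV[R]_n := [set y | enorm (y - x) < r].

Definition ediam E : \bar R :=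
  ereal_sup [set (enorm (x - y))%:E | x in E & y in E].

Definition box a b : set 'rV[R]_n :=
  [set x | forall i, a 0 i <= x 0 i <= b 0 i].

(* The case of the empty set matters when n = 0, where every box has
   volume 1. *)
Definition lebesgue_gauge E : \bar R :=
  if E == set0 then 0%E
  else ereal_inf [set (\prod_i (ab.2 0 i - ab.1 0 i))%:E |
                  ab in [set ab : 'rV[R]_n * 'rV[R]_n | E `<=` box ab.1 ab.2]].

Definition lebesgue_outer : set 'rV[R]_n -> \bar R := cover_outer lebesgue_gauge.

Lemma lebesgue_gauge0 : lebesgue_gauge set0 = 0%E.
Proof. by rewrite /lebesgue_gauge eqxx. Qed.

Lemma lebesgue_gauge_ge0 E : (0 <= lebesgue_gauge E)%E.
Proof.
rewrite /lebesgue_gauge; case: ifPn => // /set0P[x Ex].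
apply: le_ereal_inf_tmp => _ [[a b] /= Eab <-].
rewrite lee_fin; apply: prodr_ge0 => i _.
by rewrite subr_ge0; have /andP[] := Eab x Ex i; exact: le_trans.
Qed.

HB.instance Definition _ := isOuterMeasure.Build R 'rV[R]_n lebesgue_outer
  (cover_outer0 lebesgue_gauge0 lebesgue_gauge_ge0)
  (cover_outer_ge0 lebesgue_gauge_ge0)
  (@le_cover_outer _ _ _)
  (cover_outer_sigma_subadditive lebesgue_gauge_ge0).

Definition unit_ball_volume : R := fine (lebesgue_outer [set x | enorm x <= 1]).

End euclidean.

Section hausdorff.
Variables (R : realType) (n s : nat).
Implicit Types (E X : set 'rV[R]_n) (delta : R).

Definition hausdorff_gauge delta E : \bar R :=
  if E == set0 then 0%E
  else if (ediam E <= delta%:E)%E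
  then (unit_ball_volume R s * (fine (ediam E) / 2) ^+ s)%:E
  else +oo%E.

(* Normalized so that the s-dimensional measure agrees with area. *)
Definition hausdorff_outer X : \bar R :=
  ereal_sup [set cover_outer (hausdorff_gauge delta) X |
             delta in [set delta : R | 0 < delta]].

Lemma hausdorff_gauge0 delta : hausdorff_gauge delta set0 = 0%E.
Proof. by rewrite /hausdorff_gauge eqxx. Qed.

Lemma hausdorff_gauge_ge0 delta E : (0 <= hausdorff_gauge delta E)%E.
Proof.
rewrite /hausdorff_gauge; case: ifPn => // /set0P[x Ex].
case: ifPn => // _; rewrite lee_fin mulr_ge0 ?exprn_ge0 ?divr_ge0 ?fine_ge0 //.
  exact: outer_measure_ge0.
apply: le_ereal_sup_tmp; exists (enorm (x - x))%:E; last by rewrite lee_fin sqrtr_ge0.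
by exists x => //; exists x.
Qed.

Let hausdorff0 : hausdorff_outer set0 = 0%E.
Proof.
apply/eqP; rewrite eq_le; apply/andP; split.
  apply: ge_ereal_sup => _ [d /= _ <-].
  by rewrite (cover_outer0 (hausdorff_gauge0 d) (hausdorff_gauge_ge0 d)).
apply: le_ereal_sup_tmp; exists (cover_outer (hausdorff_gauge 1) set0).
  by exists 1 => //=.
exact: (cover_outer_ge0 (hausdorff_gauge_ge0 1)).
Qed.

Let hausdorff_ge0 X : (0 <= hausdorff_outer X)%E.
Proof.
apply: le_ereal_sup_tmp; exists (cover_outer (hausdorff_gauge 1) X).
  by exists 1 => //=.
exact: (cover_outer_ge0 (hausdorff_gauge_ge0 1)).
Qed.

Let le_hausdorff : {homo hausdorff_outer : A B / A `<=` B >-> (A <= B)%E}.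
Proof.
move=> A B AB; apply: ge_ereal_sup => _ [d /= d0 <-].
apply: le_ereal_sup_tmp; exists (cover_outer (hausdorff_gauge d) B).
  by exists d.
exact: le_cover_outer.
Qed.

Let hausdorff_subadditive : sigma_subadditive hausdorff_outer.
Proof.
move=> F; apply: ge_ereal_sup => _ [d /= d0 <-].
apply: (le_trans (cover_outer_sigma_subadditive (hausdorff_gauge_ge0 d) F)).
apply: lee_nneseries => i *; first exact: (cover_outer_ge0 (hausdorff_gauge_ge0 d)).
by apply: ereal_sup_ubound; exists d.
Qed.

HB.instance Definition _ := isOuterMeasure.Build R 'rV[R]_n hausdorff_outer
  hausdorff0 hausdorff_ge0 le_hausdorff hausdorff_subadditive.

End hausdorff.

Section C2_domains.
Variable R : realType.

Definition partial n (i : 'I_n) (f : 'rV[R]_n -> R) (x : 'rV[R]_n) : R :=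
  'D_(delta_mx 0 i) f x.

Definition C1 n (f : 'rV[R]_n -> R) :=
  forall i, (forall x, derivable f x (delta_mx 0 i)) /\ continuous (partial i f).

Definition C2 n (f : 'rV[R]_n -> R) := C1 f /\ forall i, C1 (partial i f).

Definition boundary n (Omega : set 'rV[R]_n) : set 'rV[R]_n :=
  closure Omega `\` interior Omega.

(* Near each boundary point, Omega is the strict epigraph of a C^2 function
   of n variables in the orthonormal coordinates y *m Q. *)
Definition C2_boundary n (Omega : set 'rV[R]_n.+1) :=
  forall x, boundary Omega x ->
  exists (r : R) (Q : 'M[R]_n.+1) (phi : 'rV[R]_n -> R),
    [/\ 0 < r, Q *m Q^T = 1%:M, C2 phi &
        forall y, eball x r y ->
          Omega y <-> phi (col' ord_max (y *m Q)) < (y *m Q) 0 ord_max].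

Definition bounded_C2_domain n (Omega : set 'rV[R]_n.+1) :=
  [/\ open Omega, connected Omega, Omega !=set0, bounded_set Omega
    & C2_boundary Omega].

End C2_domains.

Section measures_on_domains.
Variables (R : realType) (n : nat) (Omega : set 'rV[R]_n.+1).

Definition domain_outer : {outer_measure set 'rV[R]_n.+1 -> \bar R} :=
  restr_outer (@lebesgue_outer R n.+1) Omega.

Definition surface_outer : {outer_measure set 'rV[R]_n.+1 -> \bar R} :=
  restr_outer (@hausdorff_outer R n.+1 n) (boundary Omega).

Definition domain_measure :
    {measure set (caratheodory_type domain_outer) -> \bar R} :=
  (domain_outer : set (caratheodory_type domain_outer) -> \bar R).

Definition surface_measure :
    {measure set (caratheodory_type surface_outer) -> \bar R} :=
  (surface_outer : set (caratheodory_type surface_outer) -> \bar R).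

End measures_on_domains.

Section bounded_variation.
Variables (R : realType) (n : nat) (Omega : set 'rV[R]_n.+1).
Local Notation mu := (domain_measure Omega).
Local Notation sigma := (surface_measure Omega).

Definition divergence (phi : 'rV[R]_n.+1 -> 'rV[R]_n.+1) (x : 'rV[R]_n.+1) : R :=
  \sum_i partial i (fun y => phi y 0 i) x.

Definition C1c_field (phi : 'rV[R]_n.+1 -> 'rV[R]_n.+1) :=
  (forall i, C1 (fun y => phi y 0 i)) /\
  exists K, [/\ compact K, K `<=` Omega & forall x, ~ K x -> phi x = 0].

Definition total_variation (w : 'rV[R]_n.+1 -> R) : \bar R :=
  ereal_sup [set (\int[mu]_x (w x * divergence phi x)%:E)%E |
             phi in [set phi | C1c_field phi /\ forall x, enorm (phi x) <= 1]].

Definition BV (w : 'rV[R]_n.+1 -> R) :=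
  w \in Lfun mu 1 /\ (total_variation w < +oo)%E.

(* g is the trace of w: at almost every boundary point x, the averages of
   |w - g x| over the part of Omega in the r-ball around x tend to 0. *)
Definition is_trace (w g : 'rV[R]_n.+1 -> R) :=
  g \in Lfun sigma 1 /\
  {ae sigma, forall x : 'rV[R]_n.+1,
    ((r ^- n.+1)%:E * \int[mu]_(y in eball x r) `|w y - g x|%:E)%E
      @[r --> 0^'+] --> 0%E}.

Definition trace_operator (gamma : ('rV[R]_n.+1 -> R) -> 'rV[R]_n.+1 -> R) :=
  forall w, BV w -> is_trace w (gamma w).

End bounded_variation.

Section gradient_flows.
(* A Hilbert space is presented by a module V of representatives (here square
   integrable functions) and a positive semidefinite form ip on it; the vectors
   are the elements of V up to [nrm (x - y) = 0], so that equality of vectors is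
   written that way below. *)
Variables (R : realType) (V : lmodType R) (ip : V -> V -> R).
Implicit Types (E : V -> \bar R) (u g : R -> V) (x v : V).
Local Notation lambda := (@lebesgue_measure R).

Definition nrm x : R := Num.sqrt (ip x x).

Definition domain_closure E : set V :=
  [set x | forall eps : R, 0 < eps -> exists v, (E v < +oo)%E /\ nrm (x - v) < eps].

Definition subdifferential E x : set V :=
  [set xi | (E x < +oo)%E /\ forall v, (E x + (ip xi (v - x))%:E <= E v)%E].

Record simple_fun := SimpleFun {
  sf_card : nat;
  sf_set : 'I_sf_card -> set R;
  sf_val : 'I_sf_card -> V;
  sf_measurable : forall i, measurable (sf_set i) }.
Arguments sf_set : clear implicits.
Arguments sf_val : clear implicits.

Definition sf_eval (s : simple_fun) (t : R) : V :=
  \sum_i \1_(sf_set s i) t *: sf_val s i.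

Definition sf_integral (A : set R) (s : simple_fun) : V :=
  \sum_i fine (lambda (A `&` sf_set s i)) *: sf_val s i.

(* v is the Bochner integral of f over a bounded interval A. *)
Definition bochner_integral (A : set R) (f : R -> V) (v : V) :=
  exists s : nat -> simple_fun,
    [/\ forall k, measurable_fun A (fun t => nrm (f t - sf_eval (s k) t)),
        (\int[lambda]_(t in A) (nrm (f t - sf_eval (s k) t))%:E)%E
          @[k --> \oo] --> 0%E
      & nrm (sf_integral A (s k) - v) @[k --> \oo] --> 0].

Definition L1loc (T : R) (f : R -> V) :=
  forall a : R, 0 < a < T -> exists v, bochner_integral `[a, T] f v.

Definition C1c_interval (T : R) (phi : R -> R) :=
  [/\ forall t, derivable phi t 1, continuous (derive1 phi) &
      exists a b : R, [/\ 0 < a, b < T & forall t : R, t \notin `[a, b] -> phi t = 0]].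

(* u belongs to W^{1,1}_loc(]0, T], V), with weak derivative g. *)
Definition W11loc (T : R) u g :=
  [/\ L1loc T u, L1loc T g &
      forall phi, C1c_interval T phi -> exists v,
        bochner_integral `[0, T] (fun t => derive1 phi t *: u t) v /\
        bochner_integral `[0, T] (fun t => phi t *: g t) (- v)].

Definition continuous_on (T : R) u :=
  forall t : R, t \in `[0, T] ->
    nrm (u s - u t) @[s --> within [set` `[0, T]] (nbhs t)] --> 0.

Definition flow_solution E (u0 : V) (T : R) u :=
  [/\ continuous_on T u, nrm (u 0 - u0) = 0 &
      exists g, W11loc T u g /\
        {ae lambda, forall t : R, t \in `]0, T[ -> subdifferential E (u t) (- g t)}].

(* Solutions are unique up to distance 0, so for convex lower semicontinuous E
   this determines S on the closure of the domain. *)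
Definition gradient_flow E (S : V -> R -> V) :=
  forall u0 : V, domain_closure E u0 ->
    forall T : R, 0 < T -> flow_solution E u0 T (S u0).

End gradient_flows.

Section convergence_of_flows.
Variables (R : realType).
Variables (X : R -> lmodType R) (ip : forall tau, X tau -> X tau -> R).
Variables (Y : lmodType R) (ipY : Y -> Y -> R) (L : forall tau, X tau -> Y).

Definition strongly_converges (w : forall tau, X tau) (w0 : Y) :=
  nrm (@ip tau) (w tau) @[tau --> +oo] --> nrm ipY w0 /\
  nrm ipY (L (w tau) - w0) @[tau --> +oo] --> 0.

Definition flows_converge_uniformly
    (E : forall tau, X tau -> \bar R) (S : forall tau, X tau -> R -> X tau)
    (EY : Y -> \bar R) (SY : Y -> R -> Y) :=
  forall (T : R) (u : forall tau, X tau) (u0 : Y), 0 < T ->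
    domain_closure ipY EY u0 ->
    (forall tau : R, 0 < tau -> domain_closure (@ip tau) (@E tau) (u tau)) ->
    strongly_converges u u0 ->
    (forall eps : R, 0 < eps -> \forall tau \near +oo, forall t : R, t \in `[0, T] ->
       nrm ipY (L (S tau (u tau) t) - SY u0 t) <= eps) /\
    (forall eps : R, 0 < eps -> \forall tau \near +oo, forall t : R, t \in `[0, T] ->
       `|nrm (@ip tau) (S tau (u tau) t) - nrm ipY (SY u0 t)| <= eps).

End convergence_of_flows.

Section dynamic_boundary_energies.
Variables (R : realType) (n : nat) (Omega : set 'rV[R]_n.+1).
Variable gamma : ('rV[R]_n.+1 -> R) -> 'rV[R]_n.+1 -> R.
Local Notation mu := (domain_measure Omega).
Local Notation sigma := (surface_measure Omega).

Lemma le1_2 : (1 <= 2%:E :> \bar R)%E.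
Proof. by rewrite lee_fin ler1n. Qed.

Definition X_infty : lmodType R := LfunType mu le1_2.
Definition X_pair : lmodType R := (LfunType mu le1_2 * LfunType sigma le1_2)%type.

Definition L_pair (w : X_pair) : X_infty := w.1.

Definition ip_infty (w v : X_infty) : R := (\int[mu]_x (w x * v x))%R.

Definition ip_pair (tau : R) (w v : X_pair) : R :=
  (\int[mu]_x (w.1 x * v.1 x) + tau * \int[sigma]_x (w.2 x * v.2 x))%R.

Definition E_infty (w : X_infty) : \bar R :=
  if `[< BV Omega w >]
  then (total_variation Omega w + \int[sigma]_x `|gamma w x|%:E)%E
  else +oo%E.

Definition E_pair (w : X_pair) : \bar R :=
  if `[< BV Omega w.1 >]
  then (total_variation Omega w.1 + \int[sigma]_x `|gamma w.1 x - w.2 x|%:E)%E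
  else +oo%E.

End dynamic_boundary_energies.

(* Main.v *)
Require Import Defs.
From mathcomp Require Import all_boot all_order all_algebra.
From mathcomp Require Import all_classical all_reals all_analysis measurable_realfun.
From mathcomp Require finmap.
From mathcomp Require Import ring lra.

(** The two flows can be compared directly. Let u = (u1, u2) solve the flow of
    E_pair in the space weighted by tau, and let y solve the flow of E_infty.
    The map y |-> (y, 0) embeds the limit space isometrically and
    E_pair (y, 0) = E_infty y, so (y, 0) is admissible in the subdifferential
    inequality of u; conversely u1 is admissible in that of y. Because
    E_infty u1 <= E_pair u + int |u2|, adding the two inequalities cancels the
    energies and leaves, with w = u - (y, 0),

      <w', w> <= int |u2| <= C |u2| <= (C / sqrt tau) |w|

    almost everywhere in time (subdifferential_cross), where C is finite because
    the boundary has finite area. Hence |w t| <= |w 0| + 2 (C / sqrt tau) T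
    (comparison_le). The initial distance |w 0| tends to zero by strong
    convergence (strongly_converges_extend) and the second term tends to zero
    with 1 / tau. Both claims follow, since |u1 - y| and the difference of the
    norms of u and y are bounded by |w|.

    Passing from <w', w> <= c |w| to a bound on |w| takes some care, since the
    derivatives are weak and the Bochner integrals act on representatives. The
    weak equations are paired with the fixed vector w b and tested with cutoff
    functions, which bounds |w b|^2 - |w a|^2 on intervals where w oscillates
    little; these bounds are then chained.

    Finiteness of the area (bounded_C2_domain_perimeter_lty) holds because the
    compact boundary is a finite union of graphs of Lipschitz functions, and such
    a graph over a cube is covered by N ^ n sets of diameter of order 1 / N. *)

Set Implicit Arguments.
Unset Strict Implicit.
Unset Printing Implicit Defensive.

Import Order.TTheory GRing.Theory Num.Theory.
Import numFieldNormedType.Exports.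

Local Open Scope classical_set_scope.
Local Open Scope ring_scope.

(** * Semi-inner products *)

Section semi_inner_products.
Context {R : realType} {V : lmodType R}.
Implicit Types (ip : V -> V -> R).

(** Vectors at distance zero represent the same element of the Hilbert space,
    so the form may be degenerate. *)
Definition semi_inner ip :=
  [/\ forall x y, ip x y = ip y x,
      forall a x y z, ip (a *: x + y) z = a * ip x z + ip y z
    & forall x, 0 <= ip x x].

Variable ip : V -> V -> R.
Hypothesis ipP : semi_inner ip.
Local Notation nrm := (nrm ip).

Lemma ipC x y : ip x y = ip y x.
Proof. by have [+ _ _] := ipP; apply. Qed.

Lemma ipDl x y z : ip (x + y) z = ip x z + ip y z.
Proof. by have [_ /(_ 1 x y z) + _] := ipP; rewrite scale1r mul1r. Qed.

Lemma ip0l z : ip 0 z = 0.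
Proof. by have := ipDl 0 0 z; rewrite addr0; lra. Qed.

Lemma ipZl a x z : ip (a *: x) z = a * ip x z.
Proof. by have [_ /(_ a x 0 z) + _] := ipP; rewrite ip0l !addr0. Qed.

Lemma ipNl x z : ip (- x) z = - ip x z.
Proof. by rewrite -scaleN1r ipZl mulN1r. Qed.

Lemma ipBl x y z : ip (x - y) z = ip x z - ip y z.
Proof. by rewrite ipDl ipNl. Qed.

Lemma ipDr x y z : ip x (y + z) = ip x y + ip x z.
Proof. by rewrite ipC ipDl !(ipC x). Qed.

Lemma ipBr x y z : ip x (y - z) = ip x y - ip x z.
Proof. by rewrite ipC ipBl !(ipC x). Qed.

Lemma ipZr a x z : ip x (a *: z) = a * ip x z.
Proof. by rewrite ipC ipZl ipC. Qed.

Lemma ip_suml (I : Type) (r : seq I) (F : I -> V) z :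
  ip (\sum_(i <- r) F i) z = \sum_(i <- r) ip (F i) z.
Proof. by elim/big_rec2: _ => [|i x y _ <-]; rewrite ?ip0l// ipDl. Qed.

Lemma nrm_ge0 x : 0 <= nrm x.
Proof. exact: sqrtr_ge0. Qed.

Lemma nrm_sqr x : nrm x ^+ 2 = ip x x.
Proof. by rewrite sqr_sqrtr//; have [_ _] := ipP. Qed.

Lemma nrmN x : nrm (- x) = nrm x.
Proof. by rewrite /Defs.nrm ipNl ipC ipNl opprK. Qed.

Lemma nrm_distC x y : nrm (x - y) = nrm (y - x).
Proof. by rewrite -nrmN opprB. Qed.

Lemma cauchy_schwarz x y : ip x y <= nrm x * nrm y.
Proof.
(* The discriminant of this nonnegative quadratic polynomial is nonpositive. *)
have quad t : 0 <= ip x x + 2 * t * ip x y + t ^+ 2 * ip y y.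
  have [_ _ /(_ (x + t *: y))] := ipP.
  by rewrite ipDl !ipDr !ipZr !ipZl (ipC y x); lra.
suff : ip x y ^+ 2 <= ip x x * ip y y.
  rewrite -(nrm_sqr x) -(nrm_sqr y) -exprMn => h.
  have [xy|/ltW xy] := leP (ip x y) 0.
    by rewrite (le_trans xy)// mulr_ge0 ?nrm_ge0.
  by rewrite -(@ler_pXn2r _ 2) ?nnegrE// mulr_ge0 ?nrm_ge0.
have [_ _ /(_ y)] := ipP.
rewrite le_eqVlt => /predU1P[yy0|yy_gt0].
  rewrite -yy0 mulr0.
  have [->|xy0] := eqVneq (ip x y) 0; first by rewrite expr0n.
  have := quad (- (ip x x + 1) / (2 * ip x y)).
  rewrite -yy0 mulr0 addr0.
  have -> : 2 * (- (ip x x + 1) / (2 * ip x y)) * ip x y = - (ip x x + 1).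
    by field.
  lra.
have := quad (- ip x y / ip y y).
have -> : ip x x + 2 * (- ip x y / ip y y) * ip x y + (- ip x y / ip y y) ^+ 2 * ip y y
  = (ip x x * ip y y - ip x y ^+ 2) / ip y y by field; rewrite gt_eqF.
by rewrite pmulr_lge0 ?invr_gt0// subr_ge0.
Qed.

Lemma nrm_triangle x y : nrm (x + y) <= nrm x + nrm y.
Proof.
rewrite -(@ler_pXn2r _ 2) ?nnegrE ?addr_ge0 ?nrm_ge0//.
rewrite sqrrD !nrm_sqr ipDl !ipDr (ipC y x).
by have := cauchy_schwarz x y; lra.
Qed.

Lemma nrm_dist_triangle z x y : nrm (x - y) <= nrm (x - z) + nrm (z - y).
Proof. by have := nrm_triangle (x - z) (z - y); rewrite addrA subrK. Qed.

Lemma nrm_lipschitz x y : `|nrm x - nrm y| <= nrm (x - y).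
Proof.
rewrite ler_norml; apply/andP; split.
  by have := nrm_triangle (y - x) x; rewrite subrK (nrm_distC y); lra.
by have := nrm_triangle (x - y) y; rewrite subrK; lra.
Qed.

Lemma abs_ip_le x y : `|ip x y| <= nrm x * nrm y.
Proof.
rewrite ler_norml cauchy_schwarz andbT lerNl -ipNl.
by rewrite (le_trans (cauchy_schwarz _ _))// nrmN.
Qed.

End semi_inner_products.

(** * Cutoff functions *)

Section cutoffs.
Context {R : realType}.
Implicit Types (p e x h : R).

(** A quadratic error bound treats the regular points and the kink of a
    piecewise polynomial function uniformly. *)
Lemma is_derive_quadratic_error (f : R -> R) (x d C : R) :
  (forall h, `|f (x + h) - f x - d * h| <= C * h ^+ 2) -> is_derive x 1 f d.
Proof.
move=> fC.
have fd : h^-1 *: (f (h + x) - f x) @[h --> 0^'] --> d.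
  apply/cvgrPdist_le => eps eps0.
  have C0 : 0 <= C by have := le_trans (normr_ge0 _) (fC 1); rewrite expr1n mulr1.
  have eC : 0 < eps / (C + 1) by rewrite divr_gt0// ltr_wpDl.
  near=> h.
  have h0 : h != 0 by near: h; exact: nbhs_dnbhs_neq.
  have he : `|h| <= eps / (C + 1).
    near: h; apply: dnbhs0_le; exact: eC.
  rewrite distrC [_ *: _]/(h^-1 * _).
  have -> : h^-1 * (f (h + x) - f x) - d = h^-1 * (f (x + h) - f x - d * h).
    by rewrite (addrC x) [RHS]mulrBr; congr (_ - _); field.
  rewrite normrM normfV ler_pdivrMl ?normr_gt0//.
  apply: le_trans (fC h) _.
  rewrite -real_normK ?num_real// expr2 mulrCA ler_wpM2l//.
  apply: le_trans (_ : (C + 1) * `|h| <= _); first by rewrite ler_wpM2r// lerDl.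
  by rewrite mulrC -ler_pdivlMr// ltr_wpDl.
have E : (fun h => h^-1 *: ((f \o shift x) (h *: 1) - f x))
  = (fun h => h^-1 *: (f (h + x) - f x)).
  by apply/funext => h /=; rewrite [h *: 1]mulr1.
apply: DeriveDef.
  by rewrite /derivable E; apply/cvg_ex; exists d.
by rewrite /derive E; apply/cvg_lim.
Unshelve. all: by end_near. Qed.

Definition ramp x : R := Num.max 0 x.

Lemma ramp_continuous : continuous ramp.
Proof.
by move=> x; apply: (@continuous_max R R (cst 0) id); [exact: cvg_cst|exact: cvg_id].
Qed.

(** This is the square of the positive part: a C^1 function with a kink in its
    derivative. *)
Definition sramp x : R := x * ramp x.

Lemma ramp_cases x : (x <= 0 /\ ramp x = 0) \/ (0 <= x /\ ramp x = x).
Proof. by rewrite /ramp; case: (leP 0 x) => [|/ltW]; [right|left]. Qed.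

Lemma is_derive_sramp p x : is_derive x 1 (fun y => sramp (y - p)) (2 * ramp (x - p)).
Proof.
apply: (@is_derive_quadratic_error _ _ _ 1) => h; rewrite /sramp.
have -> : x + h - p = x - p + h by ring.
move: (x - p) => {}x; rewrite mul1r ler_norml.
have [[? ->]|[? ->]] := ramp_cases x; have [[? ->]|[? ->]] := ramp_cases (x + h);
  apply/andP; split; nra.
Qed.

(** The triangular probability density on the interval from p to p + 2 e,
    written as a second difference of ramps. *)
Definition hat p e x : R :=
  (ramp (x - p) - 2 * ramp (x - (p + e)) + ramp (x - (p + 2 * e))) / e ^+ 2.
(** The distribution function of that density. *)
Definition step p e x : R :=
  (sramp (x - p) - 2 * sramp (x - (p + e)) + sramp (x - (p + 2 * e))) / (2 * e ^+ 2).

Lemma hat_continuous p e : continuous (hat p e).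
Proof.
move=> x; apply: cvgMl.
have r q : (fun x => ramp (x - q)) y @[y --> x] --> ramp (x - q).
  apply: (@cvg_comp _ _ _ (fun y => y - q) ramp _ (nbhs (x - q))); last exact: ramp_continuous.
  by apply: cvgB; [exact: cvg_id|exact: cvg_cst].
apply: cvgD; [apply: cvgB|]; [exact: r| |exact: r].
apply: cvgM; [exact: cvg_cst|exact: r].
Qed.

Lemma is_derive_step p e x : 0 < e -> is_derive x 1 (step p e) (hat p e x).
Proof.
move=> e0.
have d q := is_derive_sramp q x.
pose f := (2 * e ^+ 2)^-1 \*: ((fun y => sramp (y - p))
  - 2 \*: (fun y => sramp (y - (p + e))) + (fun y => sramp (y - (p + 2 * e)))).
have -> : step p e = f.
  apply/funext => y; rewrite /f /step mulrC. by [].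
apply: is_derive_eq.
rewrite /hat /GRing.scale /=; field. by rewrite gt_eqF.
Qed.

Lemma hat_ge0 p e x : 0 < e -> 0 <= hat p e x.
Proof.
move=> e0; rewrite /hat divr_ge0 ?sqr_ge0//.
have [[? ->]|[? ->]] := ramp_cases (x - p);
have [[? ->]|[? ->]] := ramp_cases (x - (p + e));
have [[? ->]|[? ->]] := ramp_cases (x - (p + 2 * e)); lra.
Qed.

Lemma hat_out p e x : 0 < e -> x <= p \/ p + 2 * e <= x -> hat p e x = 0.
Proof.
move=> e0 xo; rewrite /hat; apply/eqP; rewrite mulf_eq0; apply/orP; left; apply/eqP.
have [[? ->]|[? ->]] := ramp_cases (x - p);
have [[? ->]|[? ->]] := ramp_cases (x - (p + e));
have [[? ->]|[? ->]] := ramp_cases (x - (p + 2 * e)); case: xo; lra.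
Qed.

Lemma step_left p e x : 0 < e -> x <= p -> step p e x = 0.
Proof.
move=> e0 xp; rewrite /step /sramp /ramp !max_l; lra.
Qed.

Lemma step_right p e x : 0 < e -> p + 2 * e <= x -> step p e x = 1.
Proof.
move=> e0 xp; rewrite /step /sramp /ramp !max_r; [|lra..].
by field; rewrite gt_eqF.
Qed.

Lemma step_ge0_le1 p e x : 0 < e -> 0 <= step p e x <= 1.
Proof.
move=> e0.
have h : 0 < 2 * e ^+ 2 by rewrite mulr_gt0// exprn_gt0.
rewrite /step /sramp; apply/andP; split.
  rewrite divr_ge0 ?(ltW h)//.
  have [[? ->]|[? ->]] := ramp_cases (x - p);
  have [[? ->]|[? ->]] := ramp_cases (x - (p + e));
  have [[? ->]|[? ->]] := ramp_cases (x - (p + 2 * e)); nra.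
rewrite ler_pdivrMr// mul1r.
have [[? ->]|[? ->]] := ramp_cases (x - p);
have [[? ->]|[? ->]] := ramp_cases (x - (p + e));
have [[? ->]|[? ->]] := ramp_cases (x - (p + 2 * e)); nra.
Qed.

End cutoffs.

(** * The du Bois-Reymond lemma *)

Section du_bois_reymond.
Context {R : realType}.
Local Notation lambda := (@lebesgue_measure R).

Lemma integrable_within_continuous (a b : R) (f : R -> R) :
  {within `[a, b], continuous f} -> lambda.-integrable `[a, b] (EFin \o f).
Proof. by move=> cf; apply: continuous_compact_integrable => //; exact: segment_compact. Qed.

Lemma Rintegral_hat (p e T : R) : 0 < e -> 0 < p -> p + 2 * e < T ->
  \int[lambda]_(t in `[0, T]) hat p e t = 1.
Proof.
move=> e0 p0 pT.
have T0 : 0 < T by lra.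
rewrite /Rintegral (@continuous_FTC2 _ (hat p e) (step p e) 0 T)//.
- rewrite step_right ?step_left//=; lra.
- by apply: continuous_subspaceT; exact: hat_continuous.
- have cs : continuous (step p e).
    by move=> x; apply/differentiable_continuous/derivable1_diffP; have [] := is_derive_step p x e0.
  split; first by move=> x _; have [] := is_derive_step p x e0.
  + exact/cvg_at_right_filter/cs.
  + exact/cvg_at_left_filter/cs.
- by move=> x _; rewrite derive1E; have [] := is_derive_step p x e0.
Qed.

(** The du Bois-Reymond lemma in the form of an inequality. Testing with a
    trapezoid phi that rises right of a and falls left of b makes the integral of
    - phi' f the difference of an average of f near b and one near a; by
    continuity of f these averages are as close as desired to f b and f a. *)
Lemma increment_le (T a b B : R) (f : R -> R) : 0 < a -> a < b -> b < T ->
  {within `[0, T], continuous f} ->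
  (forall phi, C1c_interval T phi -> (forall t, 0 <= phi t <= 1) ->
     (forall t, t \notin `]a, b] -> phi t = 0) ->
     - (\int[lambda]_(t in `[0, T]) (derive1 phi t * f t)) <= B) ->
  f b - f a <= B.
Proof.
move=> a0 ab bT cf fB; apply/ler_addgt0Pr => /= eta eta0.
have T0 : 0 < T by lra.
have [cfi _ _] := (continuous_within_itvP f T0).1 cf.
have near_f (c : R) : c \in `]0, T[ -> exists2 d : R, 0 < d &
    forall t : R, `|c - t| < d -> `|f c - f t| <= eta / 2.
  move=> cT; have /cvgrPdist_le /(_ (eta / 2)) := cfi c cT.
  rewrite divr_gt0// => /(_ isT) /nbhs_ballP[d /= d0 dP].
  by exists d => // t ct; apply: dP.
have [|da da0 fa] := near_f a; first by rewrite in_itv/= a0 (lt_trans ab).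
have [|db db0 fb] := near_f b; first by rewrite in_itv/= (lt_trans a0).
pose e : R := Num.min ((b - a) / 4) (Num.min (da / 3) (db / 3)).
have e0 : 0 < e by rewrite !lt_min !divr_gt0// subr_gt0.
have [eab [eda edb]] : e <= (b - a) / 4 /\ e <= da / 3 /\ e <= db / 3.
  by rewrite /e !ge_min !lexx !orbT.
(* The ramps of phi occupy [a, a + 2 e] and [b - 2 e, b], and e is small enough
   for them to be disjoint. *)
pose phi : R -> R := fun t => step a e t - step (b - 2 * e) e t.
have dphi (t : R) : is_derive t 1 phi (hat a e t - hat (b - 2 * e) e t).
  by apply: (@is_deriveB _ _ _ (step a e) (step (b - 2 * e) e)); exact: is_derive_step.
have d1phi (t : R) : derive1 phi t = hat a e t - hat (b - 2 * e) e t.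
  by rewrite derive1E; have [] := dphi t.
have phi01 t : 0 <= phi t <= 1.
  rewrite /phi.
  have /andP[? ?] := step_ge0_le1 a t e0.
  have /andP[? ?] := step_ge0_le1 (b - 2 * e) t e0.
  have [tb|tb] := leP t (b - 2 * e).
    by rewrite (step_left e0 tb); lra.
  by rewrite (@step_right _ a)//; lra.
have phi_out t : t \notin `]a, b] -> phi t = 0.
  rewrite in_itv/= negb_and -!leNgt -ltNge => /orP tab.
  rewrite /phi.
  case: tab => tab; first by rewrite !step_left//; lra.
  by rewrite !step_right//; lra.
have cdphi : continuous (derive1 phi).
  rewrite (_ : derive1 phi = fun t => hat a e t - hat (b - 2 * e) e t); last exact/funext.
  by move=> x; apply: cvgB; exact: hat_continuous.
have phiC1 : C1c_interval T phi.
  split; first by move=> t; have [] := dphi t.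
  - exact: cdphi.
  - exists a, b; split => // t tab; apply: phi_out; apply: contra tab.
    exact: subset_itv_oc_cc.
have := fB phi phiC1 phi01 phi_out.
have chat p : {within `[0, T], continuous (hat p e)}.
  exact/continuous_subspaceT/hat_continuous.
have cst_hat p (k : R) : {within `[0, T], continuous (fun t => hat p e t * k)}.
  by move=> x; apply: cvgMl; exact: chat.
have int_hat (p k : R) : 0 < p -> p + 2 * e < T ->
    \int[lambda]_(t in `[0, T]) (hat p e t * k) = k.
  move=> p0 pT; rewrite -[RHS]mul1r -(Rintegral_hat e0 p0 pT).
  apply: RintegralZr => //; apply: integrable_within_continuous; exact: chat.
have int2 : \int[lambda]_(t in `[0, T])
    (hat (b - 2 * e) e t * (f b - eta / 2) - hat a e t * (f a + eta / 2)) = f b - f a - eta.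
  rewrite RintegralB//; try exact: integrable_within_continuous.
  by rewrite !int_hat//; lra.
rewrite -mulN1r -RintegralZl//; last first.
  apply: integrable_within_continuous => x; apply: cvgM; last exact: cf.
  by have /continuous_subspaceT := cdphi; exact.
move=> intB; rewrite -lerBlDr -int2; apply: le_trans intB.
apply: le_Rintegral => //.
- by apply: integrable_within_continuous => x; apply: cvgB; exact: cst_hat.
- apply: integrable_within_continuous => x; apply: cvgM; first exact: cvg_cst.
  apply: cvgM; last exact: cf.
  by have /continuous_subspaceT := cdphi; exact.
move=> t _; rewrite d1phi.
have h1 : hat a e t * f t <= hat a e t * (f a + eta / 2).
  have [ta|ta] := leP t a; first by rewrite hat_out// ?mul0r//; left.
  have [tb|tb] := leP (a + 2 * e) t; first by rewrite hat_out// ?mul0r//; right.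
  apply: ler_wpM2l; first exact: hat_ge0.
  by have := fa t; rewrite !ler_norml ltr_norml; lra.
have h2 : hat (b - 2 * e) e t * (f b - eta / 2) <= hat (b - 2 * e) e t * f t.
  have [ta|ta] := leP t (b - 2 * e); first by rewrite hat_out// ?mul0r//; left.
  have [tb|tb] := leP b t; first by rewrite hat_out// ?mul0r//; right; lra.
  apply: ler_wpM2l; first exact: hat_ge0.
  by have := fb t; rewrite !ler_norml ltr_norml; lra.
by lra.
Qed.

End du_bois_reymond.

(** * Pairing Bochner integrals with a vector *)

Section ae_le_Rintegral.
Context d {T : measurableType d} {R : realType} {mu : {measure set T -> \bar R}}.

(** The difference of the two functions agrees almost everywhere with its
    positive part, whose integral is nonnegative. *)
Lemma ae_le_Rintegral (D : set T) (f g : T -> R) : measurable D ->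
  mu.-integrable D (EFin \o f) -> mu.-integrable D (EFin \o g) ->
  {ae mu, forall x, D x -> f x <= g x} ->
  \int[mu]_(x in D) f x <= \int[mu]_(x in D) g x.
Proof.
move=> mD intf intg fg; rewrite -subr_ge0 -RintegralB//.
have intgf := integrableB mD intg intf.
have mgf : measurable_fun D (fun x => g x - f x).
  by have /integrableP[/measurable_EFinP] := intgf.
rewrite /Rintegral (@ae_eq_integral _ _ _ mu D (fun x => (Num.max 0 (g x - f x))%:E))//.
- by apply: fine_ge0; apply: integral_ge0 => x _; rewrite lee_fin le_max lexx.
- exact/measurable_EFinP.
- by apply/measurable_EFinP; apply: measurable_maxr.
- apply: filterS fg => x fgx Dx; rewrite max_r// subr_ge0; exact: fgx.
Qed.

End ae_le_Rintegral.

Section simple_integrals.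
Context {R : realType} {V : lmodType R}.
Local Notation lambda := (@lebesgue_measure R).
Variable A : set R.
Hypotheses (mA : measurable (A : set (measurableTypeR R))) (Afin : (lambda A < +oo)%E).

Lemma integral_weighted_indics (s : simple_fun V) (c : 'I_(sf_card s) -> R) :
  lambda.-integrable A (EFin \o (fun t => \sum_i \1_(sf_set i) t * c i)) /\
  \int[lambda]_(t in A) (\sum_i \1_(sf_set i) t * c i) =
    \sum_i fine (lambda (A `&` sf_set (s := s) i)) * c i.
Proof.
have int1 (B : set (measurableTypeR R)) : measurable B -> lambda.-integrable A (EFin \o \1_B).
  move=> mB; apply/integrableP; split.
    by apply/measurable_EFinP/measurable_funTS/measurable_indic.
  under eq_integral do rewrite gee0_abs ?lee_fin//.
  by rewrite integral_indic//; apply: le_lt_trans Afin; apply: le_measure;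
    rewrite ?inE//; exact: measurableI.
have int2 i : lambda.-integrable A (EFin \o (fun t => \1_(sf_set (s := s) i) t * c i)).
  exact: (integrableZr mA (c i) (int1 _ (sf_measurable i))).
elim: (index_enum _) => [|i r [IHint IHE]].
  split; last first.
    by rewrite big_nil; under eq_Rintegral do rewrite big_nil; rewrite Rintegral_cst// mul0r.
  under [X in _ \o X]eq_fun do rewrite big_nil; exact: integrable0.
have E : (fun t => \sum_(j <- i :: r) \1_(sf_set (s := s) j) t * c j)
  = (fun t => \1_(sf_set (s := s) i) t * c i + \sum_(j <- r) \1_(sf_set (s := s) j) t * c j).
  by apply/funext => t; rewrite big_cons.
split; first by rewrite E; exact: (integrableD mA (int2 i) IHint).
under eq_Rintegral do rewrite big_cons.
rewrite RintegralD// IHE big_cons; congr (_ + _).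
rewrite RintegralZr//; last by apply: int1; exact: sf_measurable.
by rewrite /Rintegral integral_indic// 1?setIC//; exact: sf_measurable.
Qed.

End simple_integrals.

Section bochner.
Context {R : realType} {V : lmodType R} {ip : V -> V -> R}.
Hypothesis ipP : semi_inner ip.
Local Notation lambda := (@lebesgue_measure R).
Local Notation nrm := (nrm ip).
Variable A : set R.
Hypotheses (mA : measurable (A : set (measurableTypeR R))) (Afin : (lambda A < +oo)%E).

Lemma ip_sf_eval (s : simple_fun V) t z :
  ip (sf_eval s t) z = \sum_i \1_(sf_set (s := s) i) t * ip (sf_val i) z.
Proof. by rewrite (ip_suml ipP); apply: eq_bigr => i _; rewrite (ipZl ipP). Qed.

Lemma nrm_sf_eval (s : simple_fun V) t :
  nrm (sf_eval s t) <= \sum_i \1_(sf_set (s := s) i) t * nrm (sf_val i).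
Proof.
rewrite /sf_eval; elim/big_rec2: _ => [|i x y _ xy].
  by rewrite /Defs.nrm (ip0l ipP) sqrtr0.
apply: le_trans (nrm_triangle ipP _ _) _; apply: lerD => //.
rewrite /Defs.nrm (ipZl ipP) (ipZr ipP) mulrA -expr2 sqrtrM ?sqr_ge0//.
by rewrite sqrtr_sqr ger0_norm// indicE ler0n.
Qed.

Lemma bochner_approx f v (eta : R) : bochner_integral ip A f v -> 0 < eta ->
  exists s : simple_fun V,
    [/\ lambda.-integrable A (fun t => (nrm (f t - sf_eval s t))%:E),
        \int[lambda]_(t in A) nrm (f t - sf_eval s t) <= eta
      & nrm (sf_integral A s - v) <= eta].
Proof.
move=> [s [ms /fine_cvgP[sfin /cvgrPdist_le s0] /cvgrPdist_le sv]] eta0.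
have [N _ NP] : \forall k \near \oo,
    [/\ (\int[lambda]_(t in A) (nrm (f t - sf_eval (s k) t))%:E)%E \is a fin_num,
        `|0 - fine (\int[lambda]_(t in A) (nrm (f t - sf_eval (s k) t))%:E)%E| <= eta
      & `|0 - nrm (sf_integral A (s k) - v)| <= eta].
  near=> k; split; [near: k; exact: sfin|near: k; exact: s0|near: k; exact: sv].
have [fin le1 le2] := NP N (leqnn N); exists (s N).
move: le1 le2; rewrite !sub0r !normrN => le1 le2; split.
- apply/integrableP; split; first by have /measurable_EFinP := ms N.
  under eq_integral do rewrite gee0_abs ?lee_fin ?nrm_ge0//.
  by rewrite -ge0_fin_numE//; apply: integral_ge0 => t _; rewrite lee_fin nrm_ge0.
- exact: le_trans (ler_norm _) le1.
- exact: le_trans (ler_norm _) le2.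
Unshelve. all: by end_near. Qed.

(** For a Bochner integrable f the scalar function ip (f t) z need not be Borel
    measurable: it is so only up to a Lebesgue null set, which may fail to be
    Borel. It is however squeezed between integrable functions whose integrals
    are close, namely ip (s t) z -/+ nrm z * nrm (f t - s t) with s one of the
    approximating simple functions; all later estimates go through this. *)
Lemma bochner_sandwich f v z (eta : R) : bochner_integral ip A f v -> 0 < eta ->
  exists lo hi : R -> R,
    [/\ lambda.-integrable A (EFin \o lo), lambda.-integrable A (EFin \o hi),
        forall t, A t -> lo t <= ip (f t) z <= hi t,
        ip v z <= \int[lambda]_(t in A) lo t + eta
      & \int[lambda]_(t in A) hi t - eta <= ip v z].
Proof.
move=> fv eta0.
have z0 : 0 < 2 * (nrm z + 1) by rewrite mulr_gt0// ltr_wpDl ?nrm_ge0.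
have e0 : 0 < eta / (2 * (nrm z + 1)) by rewrite divr_gt0.
have [s [intd le1 le2]] := bochner_approx fv e0.
pose c i := ip (sf_val (s := s) i) z.
have [ints intsE] := integral_weighted_indics mA Afin c.
pose d t := nrm z * nrm (f t - sf_eval s t).
have intzd : lambda.-integrable A (EFin \o d).
  rewrite (_ : _ \o _ = (fun t => (nrm z)%:E * (nrm (f t - sf_eval s t))%:E)%E)//.
  exact: integrableZl.
have intdE : \int[lambda]_(t in A) d t <= eta / 2.
  rewrite RintegralZl//; apply: le_trans (ler_wpM2l (nrm_ge0 _ _) le1) _.
  rewrite mulrA ler_pdivrMr// mulrCA; have := nrm_ge0 ip z; nra.
have sv : `|ip (sf_integral A s - v) z| <= eta / 2.
  apply: le_trans (abs_ip_le ipP _ _) _.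
  apply: le_trans (ler_wpM2r (nrm_ge0 _ _) le2) _.
  rewrite mulrAC ler_pdivrMr//; have := nrm_ge0 ip z; nra.
have sE : ip (sf_integral A s) z = \int[lambda]_(t in A) (\sum_i \1_(sf_set (s := s) i) t * c i).
  by rewrite intsE (ip_suml ipP); apply: eq_bigr => i _; rewrite (ipZl ipP).
exists (fun t => \sum_i \1_(sf_set (s := s) i) t * c i - d t).
exists (fun t => \sum_i \1_(sf_set (s := s) i) t * c i + d t).
split.
- exact: (integrableB mA ints intzd).
- exact: (integrableD mA ints intzd).
- move=> t At; have := abs_ip_le ipP (f t - sf_eval s t) z.
  rewrite (ipBl ipP) ip_sf_eval ler_norml /d mulrC; lra.
- rewrite RintegralB//; move: sv; rewrite (ipBl ipP) sE ler_norml; lra.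
- rewrite RintegralD//; move: sv; rewrite (ipBl ipP) sE ler_norml; lra.
Qed.

(** As for scalar products, the norm of f itself need not be measurable, so an
    integrable majorant replaces it. *)
Lemma bochner_nrm_bound f v : bochner_integral ip A f v ->
  exists K : R -> R, lambda.-integrable A (EFin \o K) /\
    forall t, A t -> nrm (f t) <= K t.
Proof.
move=> fv; have [s [intd _ _]] := bochner_approx fv ltr01.
have [ints _] := integral_weighted_indics mA Afin (fun i => nrm (sf_val (s := s) i)).
exists (fun t => nrm (f t - sf_eval s t) + \sum_i \1_(sf_set (s := s) i) t * nrm (sf_val i)).
split; first exact: (integrableD mA intd ints).
move=> t At; have := nrm_triangle ipP (f t - sf_eval s t) (sf_eval s t).
by rewrite subrK => /le_trans; apply; rewrite lerD2l; exact: nrm_sf_eval.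
Qed.

Lemma bochner_ip f v z (p : R -> R) : bochner_integral ip A f v ->
  lambda.-integrable A (EFin \o p) -> (forall t, A t -> ip (f t) z = p t) ->
  ip v z = \int[lambda]_(t in A) p t.
Proof.
move=> fv intp fp; apply/eqP; rewrite eq_le; apply/andP; split; apply/ler_addgt0Pr => /= eta eta0;
  have [lo [hi [ilo ihi lohi vlo vhi]]] := bochner_sandwich z fv eta0.
  apply: le_trans vlo _; rewrite lerD2r; apply: le_Rintegral => // t At.
  by rewrite -fp//; have /andP[] := lohi t At.
rewrite -lerBlDr; apply: le_trans vhi; rewrite lerD2r; apply: le_Rintegral => // t At.
by rewrite -fp//; have /andP[] := lohi t At.
Qed.

(** Stated for two integrals at once since f - g is not known to be Bochner
    integrable: the measurability of nrm (f - s) for the approximations of f and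
    of g says nothing about their differences. *)
Lemma bochner_ip_diff_le f v g w z (p : R -> R) :
  bochner_integral ip A f v -> bochner_integral ip A g w ->
  lambda.-integrable A (EFin \o p) ->
  {ae lambda, forall t, A t -> ip (f t) z - ip (g t) z <= p t} ->
  ip v z - ip w z <= \int[lambda]_(t in A) p t.
Proof.
move=> fv gw intp fgp; apply/ler_addgt0Pr => /= eta eta0.
have eta20 : 0 < eta / 2 by rewrite divr_gt0.
have [lo [hi' [ilo _ loP vlo _]]] := bochner_sandwich z fv eta20.
have [lo' [hi [_ ihi hiP _ whi]]] := bochner_sandwich z gw eta20.
have : \int[lambda]_(t in A) (lo t - hi t) <= \int[lambda]_(t in A) p t.
  apply: ae_le_Rintegral => //; first exact: (integrableB mA ilo ihi).
  move: fgp; apply: filterS; first exact: (ae_filter_ringOfSetsType lambda).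
  move=> t tp At; apply: le_trans (tp At).
  by have := loP t At; have := hiP t At; lra.
by rewrite RintegralB//; lra.
Qed.

End bochner.

(** * Comparison of two curves with weak derivatives *)

Section real_induction.
Context {R : realType}.

(** Real induction: the supremum of the t for which D a t holds is reached, and
    cannot be smaller than b. *)
Lemma chain_local_to_global (D : R -> R -> Prop) (a b : R) : a <= b ->
  (forall x, a <= x <= b -> exists2 d : R, 0 < d & forall s t,
     a <= s -> s <= t -> t <= b -> `|x - s| < d -> `|x - t| < d -> D s t) ->
  (forall s t r, D s t -> D t r -> D s r) -> D a b.
Proof.
move=> ab loc trans; pose E : set R := [set t | a <= t <= b /\ D a t].
have Ea : E a.
  split; first by rewrite lexx ab.
  have [|d d0 dP] := loc a; first by rewrite lexx ab.
  by apply: dP; rewrite ?lexx// subrr normr0.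
have ubE : ubound E b by move=> t [/andP[]].
have supE : has_sup E by split; [exists a|exists b].
have asup : a <= sup E by apply: ub_le_sup => //; exists b.
have supb : sup E <= b by apply: ge_sup => //; exists a.
have [|d d0 dP] := loc (sup E); first by rewrite asup supb.
have [s Es sups] := sup_adherent d0 supE.
have ssup : s <= sup E by apply: ub_le_sup => //; exists b.
have [/andP[as_ sb] Ds] := Es.
have sd : `|sup E - s| < d by rewrite ger0_norm ?subr_ge0//; lra.
have reach t : s <= t -> t <= b -> `|sup E - t| < d -> E t.
  move=> st tb td; split; first by rewrite (le_trans as_ st) tb.
  exact: trans Ds (dP _ _ as_ st tb sd td).
have [supltb|bsup] := ltP (sup E) b; last first.
  have -> : b = sup E by apply/eqP; rewrite eq_le bsup supb.
  have [//] : E (sup E) by apply: reach => //; rewrite subrr normr0.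
pose t := Num.min b (sup E + d / 2).
have supt : sup E < t by rewrite /t lt_min supltb ltrDl divr_gt0.
have tsup : t <= sup E + d / 2 by rewrite /t ge_min lexx orbT.
have Et : E t.
  apply: reach; [lra|by rewrite /t ge_min lexx|].
  by rewrite ltr0_norm ?subr_lt0//; lra.
have : t <= sup E by apply: ub_le_sup => //; exists b.
by rewrite leNgt supt.
Qed.

Lemma within_continuous_epsP (T : R) (f : R -> R) : {within `[0, T], continuous f} <->
  (forall t, 0 <= t <= T -> forall eta : R, 0 < eta -> exists2 d : R, 0 < d &
    forall s, 0 <= s <= T -> `|t - s| < d -> `|f t - f s| <= eta).
Proof.
split => [/subspace_continuousP cf t tT eta eta0|cf].
  have /cvgrPdist_le /(_ _ eta0) := cf t tT.
  rewrite /prop_near1 /= => /nbhs_ballP[d /= d0 dP]; exists d => // s sT ts.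
  exact: dP.
apply/subspace_continuousP => t /= tT; apply/cvgrPdist_le => eta eta0.
have [|d d0 dP] := cf t _ eta eta0; first by move: tT; rewrite in_itv.
by apply/nbhs_ballP; exists d => //= s ts sT; apply: dP => //; move: sT; rewrite in_itv.
Qed.

End real_induction.

Section continuous_curves.
Context {R : realType} {V : lmodType R} {ip : V -> V -> R}.
Hypothesis ipP : semi_inner ip.
Local Notation lambda := (@lebesgue_measure R).
Local Notation nrm := (nrm ip).
Variable T : R.

Lemma continuous_on_epsP (u : R -> V) : continuous_on ip T u ->
  forall t, 0 <= t <= T -> forall eta : R, 0 < eta -> exists2 d : R, 0 < d &
    forall s, 0 <= s <= T -> `|t - s| < d -> nrm (u s - u t) <= eta.
Proof.
move=> cu t tT eta eta0.
have tT' : t \in `[0, T] by rewrite in_itv.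
have /cvgrPdist_le /(_ _ eta0) := cu t tT'.
rewrite /prop_near1 /= => /nbhs_ballP[d /= d0 dP]; exists d => // s sT ts.
have := dP s ts; rewrite sub0r normrN ger0_norm ?nrm_ge0//; apply.
by rewrite /= in_itv.
Qed.

Lemma continuous_onB u y : continuous_on ip T u -> continuous_on ip T y ->
  continuous_on ip T (fun t => u t - y t).
Proof.
move=> cu cy t tT.
apply: (@squeeze_cvgr _ _ _ _ (fun=> 0) (fun s => nrm (u s - u t) + nrm (y s - y t))).
- near=> s; rewrite nrm_ge0/=.
  have -> : u s - y s - (u t - y t) = (u s - u t) - (y s - y t).
    by rewrite !opprD !opprK addrACA.
  by apply: le_trans (nrm_triangle ipP _ _) _; rewrite (nrmN ipP).
- exact: cvg_cst.
- rewrite -[X in _ --> X](addr0 0); apply: cvgD; [exact: cu|exact: cy].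
Unshelve. all: by end_near. Qed.

Lemma continuous_ip u z : continuous_on ip T u ->
  {within `[0, T], continuous (fun t => ip (u t) z)}.
Proof.
move=> cu; apply/within_continuous_epsP => t tT eta eta0.
have z0 : 0 < nrm z + 1 by rewrite ltr_wpDl ?nrm_ge0.
have [|d d0 dP] := continuous_on_epsP cu tT (eta := eta / (nrm z + 1)); first exact: divr_gt0.
exists d => // s sT ts; rewrite distrC -(ipBl ipP).
apply: le_trans (abs_ip_le ipP _ _) _.
apply: le_trans (_ : nrm (u s - u t) * (nrm z + 1) <= _).
  by rewrite ler_wpM2l ?nrm_ge0// lerDl.
by rewrite -ler_pdivlMr//; exact: dP.
Qed.

Lemma continuous_nrm u : continuous_on ip T u ->
  {within `[0, T], continuous (fun t => nrm (u t))}.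
Proof.
move=> cu; apply/within_continuous_epsP => t tT eta eta0.
have [d d0 dP] := continuous_on_epsP cu tT eta0.
exists d => // s sT ts; rewrite distrC.
exact: le_trans (nrm_lipschitz ipP _ _) (dP s sT ts).
Qed.

End continuous_curves.

Section comparison.
Context {R : realType} {V : lmodType R} {ip : V -> V -> R}.
Hypothesis ipP : semi_inner ip.
Local Notation lambda := (@lebesgue_measure R).
Local Notation nrm := (nrm ip).
Variables (T : R) (u y g h : R -> V).
Hypothesis T0 : 0 < T.
Hypotheses (cu : continuous_on ip T u) (cy : continuous_on ip T y).
Hypotheses (ug : W11loc ip T u g) (yh : W11loc ip T y h).
Let w t := u t - y t.

Let lambda_itv (a b : R) : (lambda `[a, b] < +oo)%E.
Proof. by rewrite lebesgue_measure_itv/=; case: ifPn => //= _; rewrite ltry. Qed.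

Let integrable_cst_itv (a b k : R) : lambda.-integrable `]a, b] (EFin \o (fun=> k)).
Proof.
have mcc : measurable (`[a, b] : set (measurableTypeR R)) by [].
have moc : measurable (`]a, b] : set (measurableTypeR R)) by [].
have icc : lambda.-integrable `[a, b] (EFin \o (fun=> k)).
  by apply: integrable_within_continuous => x; exact: cvg_cst.
by apply: (integrableS mcc moc _ icc); exact: subset_itv_oc_cc.
Qed.

Let integrable_affine (a b k omega : R) (K : R -> R) :
  lambda.-integrable `]a, b] (EFin \o K) ->
  lambda.-integrable `]a, b] (EFin \o (fun t => k + omega * K t)).
Proof.
move=> intK; have mab : measurable (`]a, b] : set (measurableTypeR R)) by [].
exact: (integrableD mab (integrable_cst_itv a b k) (integrableZl mab omega intK)).
Qed.

(** The weak formulations for u and y, tested with a cutoff phi and paired with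
    a fixed vector z, reduce the claim to the scalar increment estimate. *)
Lemma weak_increment_le (a b : R) (z : V) (p : R -> R) :
  0 < a -> a < b -> b < T -> lambda.-integrable `]a, b] (EFin \o p) ->
  (forall t, t \in `]a, b] -> 0 <= p t) ->
  {ae lambda, forall t, t \in `]a, b] -> ip (g t - h t) z <= p t} ->
  ip (w b - w a) z <= \int[lambda]_(t in `]a, b]) p t.
Proof.
move=> a0 ab bT intp p0 ghp; rewrite (ipBl ipP).
have sub : `]a, b] `<=` `[0, T].
  by move=> t; rewrite /= !in_itv/= => /andP[at_ tb]; lra.
have cw z' : {within `[0, T], continuous (fun t => ip (w t) z')}.
  exact/(continuous_ip ipP)/(continuous_onB ipP).
apply: (@increment_le _ T _ _ _ (fun t => ip (w t) z)) => // phi phiC1 phi01 phi0.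
have [_ _ /(_ _ phiC1)[vu [vu1 vu2]]] := ug.
have [_ _ /(_ _ phiC1)[vy [vy1 vy2]]] := yh.
have [_ cdphi _] := phiC1.
have int_d v : continuous_on ip T v ->
    lambda.-integrable `[0, T] (EFin \o (fun t => derive1 phi t * ip (v t) z)).
  move=> cv; have cv' : {within `[0, T], continuous (fun t => ip (v t) z)}.
    exact/(continuous_ip ipP)/cv.
  apply: integrable_within_continuous => x; apply: cvgM.
    by have /continuous_subspaceT := cdphi; exact.
  exact: cv'.
have mT : measurable (`[0, T] : set (measurableTypeR R)) by [].
have Eu : ip vu z = \int[lambda]_(t in `[0, T]) (derive1 phi t * ip (u t) z).
  apply: (bochner_ip ipP mT (lambda_itv 0 T) vu1); first exact: int_d.
  by move=> t _; rewrite (ipZl ipP).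
have Ey : ip vy z = \int[lambda]_(t in `[0, T]) (derive1 phi t * ip (y t) z).
  apply: (bochner_ip ipP mT (lambda_itv 0 T) vy1); first exact: int_d.
  by move=> t _; rewrite (ipZl ipP).
have -> : - (\int[lambda]_(t in `[0, T]) (derive1 phi t * ip (w t) z))
    = ip (- vu) z - ip (- vy) z.
  rewrite !(ipNl ipP) Eu Ey -opprD -RintegralB; [|by []|exact: int_d|exact: int_d].
  by congr (- _); apply: eq_Rintegral => t _; rewrite (ipBl ipP) mulrBr.
have -> : \int[lambda]_(t in `]a, b]) p t = \int[lambda]_(t in `[0, T]) (p \_ `]a, b]) t.
  by rewrite -Rintegral_mkcondr; congr Rintegral; apply/esym/setIidPr.
apply: (bochner_ip_diff_le ipP mT (lambda_itv 0 T) vu2 vy2).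
  rewrite -restrict_EFin; apply/integrable_restrict => //.
  by rewrite setIidr.
move: ghp; apply: filterS; first exact: (ae_filter_ringOfSetsType lambda).
move=> t ghp tT; rewrite !(ipZl ipP) -mulrBr -(ipBl ipP) patchE.
have [tab|tab] := boolP (t \in `]a, b]).
  rewrite mem_set//; have /andP[phi_ge0 phi_le1] := phi01 t.
  apply: le_trans (ler_wpM2l phi_ge0 (ghp tab)) _.
  by rewrite ler_piMl//; exact: p0.
by rewrite memNset; [rewrite phi0// mul0r|exact/negP].
Qed.

Variable c : R.
Hypothesis c0 : 0 <= c.
Hypothesis ghc : {ae lambda, forall t, t \in `]0, T[ ->
  ip (g t - h t) (w t) <= c * nrm (w t)}.

Let cN : {within `[0, T], continuous (fun t => nrm (w t))}.
Proof. exact/(continuous_nrm ipP)/(continuous_onB ipP). Qed.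

(** Take z = w b. Since |w b|^2 - |w a|^2 <= 2 ip (w b - w a) (w b), it is enough
    to bound ip (g - h) (w b) by ip (g - h) (w t), which is at most c M, plus an
    error controlled by the oscillation omega of w on the interval. *)
Lemma local_increment_le (a b M omega : R) (K : R -> R) : 0 < a -> a <= b -> b < T ->
  (forall t, t \in `]a, b] -> nrm (w t) <= M) -> 0 <= M -> 0 <= omega ->
  (forall t, t \in `]a, b] -> nrm (w b - w t) <= omega) ->
  lambda.-integrable `]a, b] (EFin \o K) ->
  (forall t, t \in `]a, b] -> nrm (g t) + nrm (h t) <= K t) ->
  nrm (w b) ^+ 2 - nrm (w a) ^+ 2 <= 2 * \int[lambda]_(t in `]a, b]) (c * M + omega * K t).
Proof.
move=> a0 + bT wM M0 om0 wom intK ghK.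
rewrite le_eqVlt => /predU1P[->|ab].
  by rewrite subrr set_itvoc0 Rintegral_set0 mulr0.
have intq : lambda.-integrable `]a, b] (EFin \o (fun t => c * M + omega * K t)).
  exact: integrable_affine.
have : ip (w b - w a) (w b) <= \int[lambda]_(t in `]a, b]) (c * M + omega * K t).
  apply: weak_increment_le => //.
    move=> t tab; rewrite addr_ge0 ?mulr_ge0//; apply: le_trans (ghK t tab).
    by rewrite addr_ge0 ?nrm_ge0.
  move: ghc; apply: filterS; first exact: (ae_filter_ringOfSetsType lambda).
  move=> t ght tab.
  have tT : t \in `]0, T[ by move: tab; rewrite !in_itv/=; lra.
  have -> : w b = w t + (w b - w t) by rewrite addrC subrK.
  rewrite (ipDr ipP); apply: lerD.
    by apply: le_trans (ght tT) _; rewrite ler_wpM2l// wM.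
  apply: le_trans (cauchy_schwarz ipP _ _) _; rewrite mulrC.
  apply: ler_pM; rewrite ?nrm_ge0//; first exact: wom.
  apply: le_trans (ghK t tab); apply: le_trans (nrm_triangle ipP _ _) _.
  by rewrite (nrmN ipP).
move: (w a) (w b) (\int[lambda]_(t in _) _) => wa wb J.
have := nrm_sqr ipP (wb - wa); have := sqr_ge0 (nrm (wb - wa)).
rewrite !(nrm_sqr ipP) !(ipBl ipP) !(ipBr ipP) (ipC ipP wb wa); lra.
Qed.

(** Chaining the local estimates over short intervals makes the oscillation
    omega arbitrarily small, which gives the bound expected from the product rule
    for the square of the norm. *)
Lemma increment_sqr_le (a b M : R) : 0 < a -> a <= b -> b < T ->
  (forall t, 0 <= t <= T -> nrm (w t) <= M) -> 0 <= M ->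
  nrm (w b) ^+ 2 - nrm (w a) ^+ 2 <= 2 * (c * M * (b - a)).
Proof.
move=> a0 ab bT wM M0.
have aT : a < T by exact: le_lt_trans bT.
have maT : measurable (`[a, T] : set (measurableTypeR R)) by [].
have aT' : 0 < a < T by rewrite a0.
have [_ /(_ a aT')[vg gv] _] := ug; have [_ /(_ a aT')[vh hv] _] := yh.
have [Kg [intKg gKg]] := bochner_nrm_bound ipP maT (lambda_itv a T) gv.
have [Kh [intKh hKh]] := bochner_nrm_bound ipP maT (lambda_itv a T) hv.
pose K t := Kg t + Kh t.
have intK : lambda.-integrable `[a, T] (EFin \o K) by exact: (integrableD maT intKg intKh).
have sub s t : a <= s -> t <= b -> `]s, t] `<=` `[a, T].
  by move=> as_ tb r; rewrite /= !in_itv/=; lra.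
have intKs s t : a <= s -> t <= b -> lambda.-integrable `]s, t] (EFin \o K).
  by move=> as_ tb; apply: (integrableS maT _ (sub s t as_ tb)).
have intq omega s t : a <= s -> t <= b ->
    lambda.-integrable `]s, t] (EFin \o (fun t => c * M + omega * K t)).
  by move=> as_ tb; apply: integrable_affine; exact: intKs.
have main omega : 0 < omega -> nrm (w b) ^+ 2 - nrm (w a) ^+ 2 <=
    2 * \int[lambda]_(t in `]a, b]) (c * M + omega * K t).
  move=> om0.
  pose D s t := a <= s /\ s <= t /\ t <= b /\ nrm (w t) ^+ 2 - nrm (w s) ^+ 2 <=
    2 * \int[lambda]_(t in `]s, t]) (c * M + omega * K t).
  suff : D a b by case=> _ [_ []].
  apply: chain_local_to_global => // [x xab|s t r [as_ [st [tb Dst]]] [_ [tr [rb Dtr]]]].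
    have om20 : 0 < omega / 2 by rewrite divr_gt0.
    have xT : 0 <= x <= T by lra.
    have [d d0 dP] := continuous_on_epsP (continuous_onB ipP cu cy) xT om20.
    exists d => // s t as_ st tb xs xt; do 3 (split => //).
    apply: local_increment_le => //; rewrite ?(ltW om0)//; try lra.
    + by move=> r; rewrite in_itv/= => rst; apply: wM; lra.
    + move=> r; rewrite in_itv/= => rst.
      have := dP t; have := dP r; rewrite -/(w _).
      have rT : 0 <= r <= T by lra.
      have tT : 0 <= t <= T by lra.
      have xr : `|x - r| < d by move: xs xt; rewrite !ltr_norml; lra.
      move=> /(_ rT xr) dr /(_ tT xt) dt.
      have := nrm_dist_triangle ipP (w x) (w t) (w r).
      by rewrite (nrm_distC ipP (w x)); lra.
    + exact: intKs.
    + move=> r rst; have ar : `[a, T]%classic r by apply: (sub s t).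
      by rewrite /K lerD// ?gKg ?hKh.
  split => //; split; first exact: le_trans tr.
  split => //.
  have -> : `]s, r]%classic = `]s, t]%classic `|` `]t, r]%classic.
    by rewrite -itv_bndbnd_setU// bnd_simp.
  rewrite Rintegral_setU//.
  - by lra.
  - by rewrite -itv_bndbnd_setU ?bnd_simp//; apply: intq.
  - apply/disj_setPS => q [/=]; rewrite !in_itv/=; lra.
have lab : lambda `]a, b] = (b - a)%:E.
  rewrite lebesgue_measure_itv/= lte_fin; case: ifPn => //=.
  by rewrite -leNgt => ba; congr (_%:E); lra.
have abE : \int[lambda]_(t in `]a, b]) (c * M) = c * M * (b - a).
  by rewrite Rintegral_cst//; congr (_ * _); exact: (congr1 fine lab).
pose I := \int[lambda]_(t in `]a, b]) K t.
have I0 : 0 <= I.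
  apply: Rintegral_ge0 => t tab; have at_ : `[a, T]%classic t by apply: (sub a b).
  by rewrite addr_ge0//; [apply: le_trans (gKg t at_)|apply: le_trans (hKh t at_)]; exact: nrm_ge0.
apply/ler_addgt0Pr => /= eta eta0.
have I1 : 0 < 2 * (I + 1) by rewrite mulr_gt0// ltr_wpDl.
have := main (eta / (2 * (I + 1))) (divr_gt0 eta0 I1).
set omega := eta / _.
have mab : measurable (`]a, b] : set (measurableTypeR R)) by [].
have intKab := intKs a b (lexx a) (lexx b).
have -> : \int[lambda]_(t in `]a, b]) (c * M + omega * K t) = c * M * (b - a) + omega * I.
  rewrite -abE -(RintegralZl omega mab intKab).
  exact: (RintegralD mab (integrable_cst_itv a b (c * M)) (integrableZl mab omega intKab)).
rewrite /omega => /le_trans; apply.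
rewrite mulrDr lerD2l.
have -> : 2 * (eta / (2 * (I + 1)) * I) = eta * (I / (I + 1)) by field; rewrite gt_eqF// ltr_wpDl.
by rewrite ler_piMr ?(ltW eta0)// ler_pdivrMr ?ltr_wpDl// mul1r lerDl.
Qed.

(** Let M be the maximum of |w| on [0, T]. The increment bound gives
    M^2 <= |w 0|^2 + 2 c M T, whence M <= |w 0| + 2 c T. The increment bound
    concerns interior times only; continuity extends it to the endpoints. *)
Lemma comparison_le t : 0 <= t <= T -> nrm (w t) <= nrm (w 0) + 2 * c * T.
Proof.
have [tm] := EVT_max (ltW T0) cN.
rewrite in_itv/= => tmT wtm.
set M := nrm (w tm) in wtm.
have wM s : 0 <= s <= T -> nrm (w s) <= M by move=> sT; apply: wtm; rewrite in_itv.
have M0 : 0 <= M by exact: nrm_ge0.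
have cN2 : {within `[0, T], continuous (fun t => nrm (w t) ^+ 2)}.
  by move=> x; apply: cvgM; exact: cN.
have bound s : 0 <= s <= T -> nrm (w s) ^+ 2 <= nrm (w 0) ^+ 2 + 2 * (c * M * T).
  move=> /andP[]; rewrite le_eqVlt => /predU1P[<- _|s0 sT].
    by rewrite lerDl !mulr_ge0// ltW.
  apply/ler_addgt0Pr => /= eta eta0.
  have eta20 : 0 < eta / 2 by rewrite divr_gt0.
  have /within_continuous_epsP cf := cN2.
  have sT' : 0 <= s <= T by rewrite ltW.
  have [d d0 dP] := cf s sT' _ eta20.
  have zT : 0 <= (0:R) <= T by rewrite lexx ltW.
  have [d' d'0 d'P] := cf 0 zT _ eta20.
  (* The interior times m' / 2 and s - m / 2 stand for 0 and s. *)
  pose m := Num.min d s; pose m' := Num.min d' s.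
  have m0 : 0 < m by rewrite lt_min d0.
  have m'0 : 0 < m' by rewrite lt_min d'0.
  have [md ms] : m <= d /\ m <= s by rewrite !ge_min !lexx !orbT.
  have [md' ms'] : m' <= d' /\ m' <= s by rewrite !ge_min !lexx !orbT.
  have := @increment_sqr_le (m' / 2) (s - m / 2) M; rewrite -/(w _).
  move=> /(_ ltac:(lra) ltac:(lra) ltac:(lra) wM M0).
  have := dP (s - m / 2); have := d'P (m' / 2).
  have -> : `|s - (s - m / 2)| = m / 2 by rewrite opprB addrC subrK ger0_norm; lra.
  have -> : `|0 - m' / 2| = m' / 2 by rewrite sub0r normrN ger0_norm; lra.
  move=> /(_ ltac:(lra) ltac:(lra)) + /(_ ltac:(lra) ltac:(lra)).
  rewrite !ler_norml => ? ? inc.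
  have : c * M * (s - m / 2 - m' / 2) <= c * M * T.
    by rewrite ler_wpM2l ?mulr_ge0//; lra.
  lra.
move=> tT; apply: le_trans (wM t tT) _.
have := bound tm tmT; rewrite -/M => MM.
have N0 := nrm_ge0 ip (w 0).
have cT0 : 0 <= 2 * c * T by rewrite !mulr_ge0// ltW.
rewrite leNgt; apply/negP => lt; move: MM; apply/negP; rewrite -ltNge; nra.
Qed.

End comparison.

(** * Transport along isometries *)

Section isometries.
Context {R : realType} {V Y : lmodType R} {ipV : V -> V -> R} {ipY : Y -> Y -> R}.
Variable iota : Y -> V.
Hypothesis iota_linear : forall a x y, iota (a *: x + y) = a *: iota x + iota y.
Hypothesis iota_isometry : forall x, nrm ipV (iota x) = nrm ipY x.

Let iotaD x y : iota (x + y) = iota x + iota y.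
Proof. by have := iota_linear 1 x y; rewrite !scale1r. Qed.

Let iota0 : iota 0 = 0.
Proof. by apply: (addrI (iota 0)); rewrite -iotaD !addr0. Qed.

Let iotaZ a x : iota (a *: x) = a *: iota x.
Proof. by have := iota_linear a x 0; rewrite iota0 !addr0. Qed.

Let iotaN x : iota (- x) = - iota x.
Proof. by rewrite -scaleN1r iotaZ scaleN1r. Qed.

Let iotaB x y : iota (x - y) = iota x - iota y.
Proof. by rewrite iotaD iotaN. Qed.

Let iota_sum (I : Type) (r : seq I) (c : I -> R) (F : I -> Y) :
  iota (\sum_(i <- r) c i *: F i) = \sum_(i <- r) c i *: iota (F i).
Proof.
by elim/big_rec2: _ => [|i x y _ <-]; rewrite ?iota0// iotaD iotaZ.
Qed.

Definition map_simple_fun (s : simple_fun Y) : simple_fun V :=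
  @SimpleFun R V (sf_card s) (sf_set (s := s)) (iota \o sf_val (s := s)) (@sf_measurable _ _ s).

Lemma bochner_isometry A f v :
  bochner_integral ipY A f v -> bochner_integral ipV A (iota \o f) (iota v).
Proof.
move=> [s [ms s0 sv]]; exists (map_simple_fun \o s).
have E k : (fun t => nrm ipV ((iota \o f) t - sf_eval ((map_simple_fun \o s) k) t)) =
    (fun t => nrm ipY (f t - sf_eval (s k) t)).
  by apply/funext => t; rewrite -iota_isometry iotaB /sf_eval iota_sum.
split.
- by move=> k; rewrite E.
- move: s0; apply: cvg_trans; apply: near_eq_cvg; near=> k.
  by apply: eq_integral => t _; have := congr1 (@^~ t) (E k) => /= ->.
- move: sv; apply: cvg_trans; apply: near_eq_cvg; near=> k.
  by rewrite -iota_isometry iotaB /sf_integral iota_sum.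
Unshelve. all: by end_near. Qed.

Lemma continuous_on_isometry (T : R) u :
  continuous_on ipY T u -> continuous_on ipV T (iota \o u).
Proof.
move=> cu t tT; have := cu t tT; apply: cvg_trans; apply: near_eq_cvg; near=> s.
by rewrite /= -iotaB iota_isometry.
Unshelve. all: by end_near. Qed.

Lemma W11loc_isometry (T : R) u g :
  W11loc ipY T u g -> W11loc ipV T (iota \o u) (iota \o g).
Proof.
move=> [Lu Lg ug]; split.
- by move=> a aT; have [v] := Lu a aT; exists (iota v); exact: bochner_isometry.
- by move=> a aT; have [v] := Lg a aT; exists (iota v); exact: bochner_isometry.
move=> phi /ug[v [v1 v2]]; exists (iota v); split.
  move/bochner_isometry : v1; congr (bochner_integral _ _ _ _).
  by apply/funext => t /=; rewrite iotaZ.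
move/bochner_isometry : v2; rewrite iotaN; congr (bochner_integral _ _ _ _).
by apply/funext => t /=; rewrite iotaZ.
Qed.

End isometries.

(** * The Hilbert space of square integrable functions *)

Section L2.
Context d (T : measurableType d) (R : realType) (m : {measure set T -> \bar R}).
Local Notation L2 := (LfunType m (@le1_2 R)).
Implicit Types f g : L2.

Lemma L2_measurable f : measurable_fun setT f.
Proof. exact: measurable_funPT. Qed.

Lemma L2_integrable_mul f g : m.-integrable setT (EFin \o (fun x => f x * g x)).
Proof. by apply/Lfun1_integrable; apply: Lfun2_mul_Lfun1; exact: LfunP. Qed.

Lemma L2_zeroE x : (0 : L2) x = 0.
Proof. by []. Qed.

Definition L2ip f g : R := \int[m]_x (f x * g x).

Lemma L2ip_semi_inner : semi_inner L2ip.
Proof.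
split=> [f g|a f g h|f].
- by apply: eq_Rintegral => x _; rewrite mulrC.
- rewrite /L2ip -RintegralZl//; last exact: L2_integrable_mul.
  rewrite -RintegralD//; last 2 first.
  - by apply: (integrableZl _ a (L2_integrable_mul f h)).
  - exact: L2_integrable_mul.
  by apply: eq_Rintegral => x _; rewrite mulrA -mulrDl.
- by apply: Rintegral_ge0 => x _; rewrite -expr2 sqr_ge0.
Qed.

Hypothesis mfin : (m setT < +oo)%E.

(** Integrate |f| <= s / 2 + f^2 / (2 s) with s slightly larger than the norm of
    f. The constant is not the sharp one of the Cauchy-Schwarz inequality, but
    only its finiteness matters below. *)
Lemma L1_le_L2 f : m.-integrable setT (EFin \o f) /\
  \int[m]_x `|f x| <= (fine (m setT) + 1) * nrm L2ip f.
Proof.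
have mfin' : m setT \is a fin_num by rewrite ge0_fin_numE.
have intf : m.-integrable setT (EFin \o f).
  apply/Lfun1_integrable; apply: (Lfun_subset12 mfin'); exact: LfunP.
split => //.
set A := fine (m setT); have A0 : 0 <= A by exact: fine_ge0.
set N := nrm L2ip f; have N0 : 0 <= N by exact: nrm_ge0.
have A1 : 0 < A + 1 by rewrite ltr_wpDl.
apply/ler_addgt0Pr => /= eta eta0.
(* The term with eta keeps s positive when f vanishes. *)
pose s := N + eta / (A + 1).
have s0 : 0 < s by rewrite ltr_wpDl// divr_gt0.
have intc k : m.-integrable setT (EFin \o (fun=> k)).
  apply/integrableP; split; first exact/measurable_EFinP.
  by rewrite /= integral_cst// ltey_eq fin_numM.
have intff := L2_integrable_mul f f.
have intbnd : m.-integrable setT (EFin \o (fun x => s / 2 + (2 * s)^-1 * (f x * f x))).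
  exact: (integrableD measurableT (intc _) (integrableZl measurableT _ intff)).
apply: (@le_trans _ _ (\int[m]_x (s / 2 + (2 * s)^-1 * (f x * f x)))).
  apply: le_Rintegral => //.
    by have /integrable_abse := intf.
  move=> x _; have -> : s / 2 + (2 * s)^-1 * (f x * f x) = (s ^+ 2 + `|f x| ^+ 2) / (2 * s).
    by rewrite real_normK ?num_real//; field; rewrite gt_eqF.
  rewrite ler_pdivlMr ?mulr_gt0//; have := sqr_ge0 (s - `|f x|); nra.
rewrite RintegralD//; last exact: (integrableZl measurableT _ intff).
rewrite (RintegralZl _ measurableT intff) Rintegral_cst// -/A -/(L2ip f f).
rewrite -(nrm_sqr L2ip_semi_inner) -/N.
have : (2 * s)^-1 * N ^+ 2 <= s / 2.
  rewrite mulrC ler_pdivrMr ?mulr_gt0//.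
  have : N <= s by rewrite /s lerDl divr_ge0 ?ltW.
  nra.
have -> : (A + 1) * N + eta = (A + 1) * s.
  by rewrite /s mulrDr; congr (_ + _); field; rewrite gt_eqF.
nra.
Qed.

Lemma integral_norm_le_sub (g : T -> R) f : measurable_fun setT g ->
  (\int[m]_x `|g x|%:E <= \int[m]_x `|g x - f x|%:E + (\int[m]_x `|f x|)%:E)%E.
Proof.
move=> mg; have mf := L2_measurable f.
have [intf _] := L1_le_L2 f.
have mgf : measurable_fun setT (fun x => g x - f x) by exact: measurable_funB.
have -> : ((\int[m]_x `|f x|)%:E = \int[m]_x `|f x|%:E)%E.
  rewrite /Rintegral fineK//; apply: integrable_fin_num => //.
  exact: integrable_abse intf.
rewrite -ge0_integralD//; last 2 first.
- by apply/measurable_EFinP/measurableT_comp.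
- by apply/measurable_EFinP/measurableT_comp.
apply: ge0_le_integral => //.
- by apply/measurable_EFinP/measurableT_comp.
- by apply: emeasurable_funD; apply/measurable_EFinP/measurableT_comp.
- by move=> x _; rewrite -EFinD lee_fin -{1}(subrK (f x) (g x)) ler_normD.
Qed.

End L2.

(** * Area of the boundary of a C^2 domain *)

Section euclidean_norm.
Context {R : realType} {n : nat}.
Implicit Types x y : 'rV[R]_n.

Definition dot x y : R := \sum_i x 0 i * y 0 i.

Lemma dot_semi_inner : semi_inner dot.
Proof.
split=> [x y|a x y z|x].
- by apply: eq_bigr => i _; rewrite mulrC.
- by rewrite /dot mulr_sumr -big_split; apply: eq_bigr => i _; rewrite !mxE mulrDl mulrA.
- by apply: sumr_ge0 => i _; rewrite -expr2 sqr_ge0.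
Qed.

Lemma enormE x : enorm x = nrm dot x.
Proof. by rewrite /enorm /nrm /dot; congr Num.sqrt; apply: eq_bigr => i _; rewrite expr2. Qed.

Lemma enorm_triangle x y : enorm (x + y) <= enorm x + enorm y.
Proof. by rewrite !enormE (nrm_triangle dot_semi_inner). Qed.

Lemma coord_le_enorm x i : `|x 0 i| <= enorm x.
Proof.
rewrite -sqrtr_sqr /enorm ler_sqrt; last by apply: sumr_ge0 => j _; exact: sqr_ge0.
by rewrite (bigD1 i)//= lerDl; apply: sumr_ge0 => j _; exact: sqr_ge0.
Qed.

Lemma enorm_le_bound x (M : R) : 0 <= M -> (forall i, `|x 0 i| <= M) -> enorm x <= n%:R * M.
Proof.
move=> M0 xM; rewrite -[leRHS]ger0_norm ?mulr_ge0// -sqrtr_sqr /enorm ler_sqrt ?sqr_ge0//.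
apply: (@le_trans _ _ (\sum_(i < n) M ^+ 2)).
  by apply: ler_sum => i _; rewrite -real_normK ?num_real// ler_pXn2r ?nnegrE.
rewrite sumr_const card_ord -[leLHS]mulr_natl exprMn; apply: ler_wpM2r; first exact: sqr_ge0.
by rewrite -natrX ler_nat; case: (n) => // k; rewrite leq_pmulr.
Qed.

Lemma enorm_orthogonal (Q : 'M[R]_n) x : Q *m Q^T = 1%:M -> enorm (x *m Q) = enorm x.
Proof.
have dotE y : \sum_i y 0 i ^+ 2 = (y *m y^T) 0 0.
  by rewrite mxE; apply: eq_bigr => i _; rewrite mxE expr2.
move=> QQ; rewrite /enorm !dotE trmx_mul mulmxA -(mulmxA x) QQ mulmx1 //.
Qed.

End euclidean_norm.

Section hausdorff_bound.
Context {R : realType} {n s : nat}.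

(** At every scale 1 / N the gauges of the N ^ s covering sets add up to at
    most the same constant. *)
Lemma hausdorff_outer_lty (X : set 'rV[R]_n) (C : R) : 0 <= C ->
  (forall N, (0 < N)%N -> exists F : {ffun 'I_s -> 'I_N} -> set 'rV[R]_n,
     X `<=` [set x | exists k, F k x] /\
     forall k x y, F k x -> F k y -> enorm (x - y) <= C / N%:R) ->
  (@hausdorff_outer R n s X < +oo)%E.
Proof.
move=> C0 cov; set v := unit_ball_volume R s.
have v0 : 0 <= v by apply: fine_ge0; exact: outer_measure_ge0.
apply: (@le_lt_trans _ _ (v * (C / 2) ^+ s)%:E); last exact: ltry.
apply: ge_ereal_sup => _ [delta /= d0 <-].
pose N := (Num.truncn (C / delta)).+1.
have N0 : 0 < N%:R :> R by [].
have CN : C / N%:R <= delta.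
  rewrite ler_pdivrMr// mulrC -ler_pdivrMr//; apply/ltW.
  by rewrite /N truncnS_gt.
have [F [XF Fd]] := cov N isT.
pose e := enum {ffun 'I_s -> 'I_N}.
(* The finite family is continued by empty sets, whose gauge vanishes. *)
pose A (k : nat) : set 'rV[R]_n := if (k < size e)%N then F (nth [ffun=> ord0] e k) else set0.
have XA : X `<=` \bigcup_k A k.
  move=> x /XF [k Fkx]; exists (index k e) => //.
  by rewrite /A index_mem mem_enum nth_index ?mem_enum.
have gauge_le k : (hausdorff_gauge s delta (F k) <= (v * (C / N%:R / 2) ^+ s)%:E)%E.
  rewrite /hausdorff_gauge; case: ifPn => [_|/set0P[x Fx]].
    by rewrite lee_fin mulr_ge0// exprn_ge0// divr_ge0// divr_ge0// ler0n.
  have diam : (ediam (F k) <= (C / N%:R)%:E)%E.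
    by apply: ge_ereal_sup => _ [a Fa [b Fb <-]]; rewrite lee_fin; exact: (Fd k a b Fa Fb).
  have diam0 : (0 <= ediam (F k))%E.
    apply: ereal_sup_ubound; exists x => //; exists x => //.
    by rewrite subrr enormE /nrm (ip0l dot_semi_inner) sqrtr0.
  have -> : (ediam (F k) <= delta%:E)%E by rewrite (le_trans diam)// lee_fin.
  rewrite lee_fin; apply: ler_wpM2l => //.
  have fd : fine (ediam (F k)) <= C / N%:R.
    rewrite -lee_fin fineK// ge0_fin_numE//; exact: le_lt_trans diam (ltry _).
  have fd0 : 0 <= fine (ediam (F k)) by exact: fine_ge0.
  by rewrite lerXn2r ?nnegrE ?divr_ge0// ler_wpM2r.
apply: (@le_trans _ _ (\sum_(k <oo) hausdorff_gauge s delta (A k))%E).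
  by apply: ereal_inf_lbound; exists A.
rewrite (@nneseries_split _ _ 0 (size e)); last by move=> k _; exact: hausdorff_gauge_ge0.
rewrite [X in (_ + X)%E]eseries0 ?adde0; last first.
  by move=> k ek _; rewrite /A ltnNge ek/=; exact: hausdorff_gauge0.
rewrite add0n; apply: (@le_trans _ _ (\sum_(0 <= k < size e) (v * (C / N%:R / 2) ^+ s)%:E)%E).
  rewrite !big_nat; apply: lee_sum => k /andP[_ ke].
  by rewrite /A ke; exact: gauge_le.
rewrite sumEFin lee_fin sumr_const_nat subn0 -cardE card_ffun !card_ord.
rewrite -[leLHS]mulr_natl mulrCA; apply: ler_wpM2l => //.
have -> : C / 2 = N%:R * (C / N%:R / 2) by field; rewrite gt_eqF.
by rewrite natrX -exprMn.
Qed.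

End hausdorff_bound.

Section outer_measure_finite_cover.
Context {R : realType} {T : Type} (mu : {outer_measure set T -> \bar R}).

Lemma outer_measure_finite_cover_lty (I : eqType) (r : seq I) (F : I -> set T) (X : set T) :
  X `<=` [set x | exists2 i, i \in r & F i x] ->
  (forall i, i \in r -> mu (F i) < +oo)%E -> (mu X < +oo)%E.
Proof.
elim: r X => [|i r IH] X Xr muF.
  suff -> : X = set0 by rewrite outer_measure0.
  by apply/seteqP; split => // x /Xr[].
apply: (@le_lt_trans _ _ (mu (F i `|` (X `\` F i)))).
  by apply: le_outer_measure => x Xx; have [|] := pselect (F i x); [left|right].
apply: le_lt_trans (outer_measureU2 mu _ _) _.
rewrite lte_add_pinfty ?muF ?mem_head//; apply: IH => [x [/Xr[j]]|j jr].
  by rewrite inE => /predU1P[->//|jr Fj _]; exists j.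
by apply: muF; rewrite inE jr orbT.
Qed.

End outer_measure_finite_cover.

Section C1_lipschitz.
Context {R : realType} {n : nat}.
Implicit Types (p q : 'rV[R]_n) (phi : 'rV[R]_n -> R).

Definition cube p : set 'rV[R]_n := [set q | forall i, `|q 0 i - p 0 i| <= 1].

Lemma cube_compact p : compact (cube p).
Proof.
rewrite (_ : cube p = [set q | forall i, `[p 0 i - 1, p 0 i + 1]%classic (q ord0 i)]).
  apply: (@rV_compact R n (fun i => `[p 0 i - 1, p 0 i + 1]%classic)) => i.
  exact: segment_compact.
by apply/seteqP; split => q pq i; have := pq i; rewrite /= in_itv/= ler_norml; lra.
Qed.

(** The mean value theorem along a coordinate line. *)
Lemma partial_bound_increment phi p (L : R) (i : 'I_n) q (t : R) :
  C1 phi -> (forall j q, cube p q -> `|partial j phi q| <= L) ->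
  cube p q -> cube p (q + t *: delta_mx 0 i) ->
  `|phi (q + t *: delta_mx 0 i) - phi q| <= L * `|t|.
Proof.
move=> phiC1 phiL pq pqt.
pose f (s : R) := phi (s *: delta_mx 0 i + q).
have df (s : R) : is_derive s 1 f (partial i phi (s *: delta_mx 0 i + q)).
  have [dphi _] := phiC1 i.
  have /derivable1P d0 := dphi (s *: delta_mx 0 i + q).
  have E : (fun h => h^-1 *: ((f \o shift s) (h *: 1) - f s)) =
    (fun h => h^-1 *: ((phi \o shift (s *: delta_mx 0 i + q)) (h *: delta_mx 0 i) -
                        phi (s *: delta_mx 0 i + q))).
    apply/funext => h; rewrite /f /=; congr (_ *: (phi _ - _)).
    by rewrite [h *: 1]mulr1 scalerDl addrA.
  apply: DeriveDef; first by rewrite /derivable E; exact: dphi.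
  by rewrite /derive E.
have cubes (s : R) : `|s| <= `|t| -> 0 <= s * t -> cube p (s *: delta_mx 0 i + q).
  move=> st st0 j; have := pq j; have := pqt j; rewrite !mxE eqxx /=.
  case: (j == i); rewrite ?mulr1 ?mulr0 ?addr0 ?add0r//.
  have [t0|t0] := leP 0 t.
    have : 0 <= s <= t.
      move: st; rewrite (ger0_norm t0) ler_norml => /andP[ts ->]; rewrite andbT.
      move: t0; rewrite le_eqVlt => /predU1P[t0|t0]; first by lra.
      by rewrite -(pmulr_lge0 _ t0).
    rewrite !ler_norml; lra.
  have : t <= s <= 0.
    move: st; rewrite (ltr0_norm t0) ler_norml opprK => /andP[-> _] /=.
    by rewrite -(nmulr_lge0 _ t0).
  rewrite !ler_norml; lra.
have cf : continuous f.
  by move=> s; apply/differentiable_continuous/derivable1_diffP; have [] := df s.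
pose df' s := partial i phi (s *: delta_mx 0 i + q).
rewrite (addrC q) -/(f t) (_ : phi q = f 0); last by rewrite /f scale0r add0r.
have [t0|t0] := leP 0 t.
  have [s] := @MVT_segment R f df' 0 t t0 (fun s _ => df s) (continuous_subspaceT cf).
  rewrite in_itv/= => /andP[s0 st] ->; rewrite subr0 normrM ler_wpM2r//.
  by apply/phiL/cubes; rewrite ?mulr_ge0// !ger0_norm.
have [s] := @MVT_segment R f df' t 0 (ltW t0) (fun s _ => df s) (continuous_subspaceT cf).
rewrite in_itv/= => /andP[ts s0] E; rewrite distrC E sub0r normrM normrN ler_wpM2r//.
apply/phiL/cubes; last by rewrite mulr_le0// ltW.
by rewrite (ltr0_norm t0) ler0_norm// lerN2.
Qed.

(** The partial derivatives are bounded on the compact cube, and one passes from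
    q to q' by changing one coordinate at a time, without leaving the cube. *)
Lemma C1_lipschitz_cube phi p : C1 phi -> exists2 L : R, 0 <= L &
  forall q q', cube p q -> cube p q' ->
    `|phi q - phi q'| <= L * \sum_i `|q 0 i - q' 0 i|.
Proof.
move=> phiC1.
have [L L0 phiL] : exists2 L : R, 0 <= L & forall j q, cube p q -> `|partial j phi q| <= L.
  have bnd j : exists2 M : R, 0 <= M & forall q, cube p q -> `|partial j phi q| <= M.
    have p0 : cube p !=set0 by exists p => i; rewrite subrr normr0.
    have cj : {within cube p, continuous (fun q => `|partial j phi q|)}.
      have [_ cpj] := phiC1 j.
      apply: continuous_subspaceT => q.
      apply: (@continuous_comp _ _ _ (partial j phi) (fun x : R => `|x|)); first exact: cpj.
      exact: norm_continuous.
    have [M _ HM] := compact_EVT_max p0 (@cube_compact p) cj.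
    exists `|partial j phi M| => // q pq; apply: HM; exact/mem_set.
  have /choice[M MP] : forall j, exists M : R, 0 <= M /\
      forall q, cube p q -> `|partial j phi q| <= M.
    by move=> j; have [M] := bnd j; exists M.
  exists (\sum_j M j) => [|j q pq].
    by apply: sumr_ge0 => j _; have [] := MP j.
  apply: le_trans (_ : M j <= _); first by have [_] := MP j; exact.
  by rewrite (bigD1 j)//= lerDl; apply: sumr_ge0 => k _; have [] := MP k.
exists L => // q q' pq pq'.
(* Induction on the number k of leading coordinates in which q and q' may
   differ. *)
have step (k : nat) : forall q, cube p q -> (forall i : 'I_n, (k <= i)%N -> q 0 i = q' 0 i) ->
    `|phi q - phi q'| <= L * \sum_i `|q 0 i - q' 0 i|.
  elim: k => [|k IH] {pq}q pq qq'.
    have -> : q = q' by apply/rowP => i; exact: qq'.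
    by rewrite subrr normr0 mulr_ge0// sumr_ge0.
  have [kn|nk] := ltnP k n; last first.
    by apply: IH => // i ki; have := leq_trans nk ki; rewrite leqNgt ltn_ord.
  pose i := Ordinal kn; pose q1 := q + (q' 0 i - q 0 i) *: delta_mx 0 i.
  have q1E j : q1 0 j = if j == i then q' 0 i else q 0 j.
    rewrite !mxE eqxx /=; case: eqVneq => [->|_]; last by rewrite mulr0 addr0.
    by rewrite mulr1 addrC subrK.
  have pq1 : cube p q1 by move=> j; rewrite q1E; case: ifP => [/eqP ->|_]; [exact: pq'|exact: pq].
  have := IH q1 pq1 _.
  have -> : \sum_i `|q 0 i - q' 0 i| = \sum_i `|q1 0 i - q' 0 i| + `|q' 0 i - q 0 i|.
    rewrite (bigD1 i)//= [in RHS](bigD1 i)//= q1E eqxx subrr normr0 add0r addrC distrC.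
    by congr (_ + _); apply: eq_bigr => j ji; rewrite q1E (negbTE ji).
  move=> IH1; rewrite mulrDr; apply: le_trans (ler_distD (phi q1) _ _) _.
  rewrite addrC; apply: lerD.
    apply: IH1 => j kj; rewrite q1E; case: eqVneq => [->//|ji].
    by apply: qq'; rewrite ltn_neqAle kj andbT; apply: contraNneq ji => kj'; apply/eqP/val_inj.
  by rewrite distrC; exact: (partial_bound_increment phiC1 phiL).
by apply: (step n) => // i; rewrite leqNgt ltn_ord.
Qed.

End C1_lipschitz.

Section boundary_is_locally_a_graph.
Context {R : realType} {n : nat}.
Variables (Omega : set 'rV[R]_n.+1) (Q : 'M[R]_n.+1) (phi : 'rV[R]_n -> R).
Variables (x : 'rV[R]_n.+1) (r : R).
Hypotheses (Oopen : open Omega) (QQ : Q *m Q^T = 1%:M) (phiC1 : C1 phi).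
Hypothesis r0 : 0 < r.
Hypothesis graph : forall y, eball x r y ->
  Omega y <-> phi (col' ord_max (y *m Q)) < (y *m Q) 0 ord_max.
Implicit Types y z : 'rV[R]_n.+1.

Let base y : 'rV[R]_n := col' ord_max (y *m Q).
Let height y : R := (y *m Q) 0 ord_max.

Let base_dist y z i : `|base y 0 i - base z 0 i| <= enorm (y - z).
Proof.
rewrite -(enorm_orthogonal _ QQ) mulmxBl.
have -> : base y 0 i - base z 0 i = (y *m Q - z *m Q) 0 (lift ord_max i) by rewrite !mxE.
exact: coord_le_enorm.
Qed.

Let height_dist y z : `|height y - height z| <= enorm (y - z).
Proof.
rewrite -(enorm_orthogonal _ QQ) mulmxBl.
have -> : height y - height z = (y *m Q - z *m Q) 0 ord_max by rewrite /height !mxE.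
exact: coord_le_enorm.
Qed.

(** A boundary point is not in the open set Omega, so its height is at most phi;
    it is a limit of points of Omega, so by continuity of phi it is at least
    phi. *)
Lemma boundary_graph y : eball x r y -> boundary Omega y -> height y = phi (base y).
Proof.
move=> xy [clOy]; rewrite -/(interior _) (interior_id _).1// => nOy.
apply/eqP; rewrite eq_le; apply/andP; split.
  by rewrite leNgt; apply/negP => /(graph xy).2.
have [L L0 phiL] := C1_lipschitz_cube (base y) phiC1.
pose m : R := n.+1%:R; have m0 : 0 < m by rewrite ltr0n.
apply/ler_addgt0Pr => /= eta eta0.
(* If z is within m e of y, then heights and values of phi change by at most
   e D. *)
pose D := m * (L * n%:R + 1).
have D0 : 0 < D by rewrite mulr_gt0// ltr_wpDl// mulr_ge0.
pose e := Num.min (eta / D) (Num.min ((r - enorm (y - x)) / (2 * m)) (1 / m)).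
have ry : 0 < r - enorm (y - x) by rewrite subr_gt0; exact: xy.
have e0 : 0 < e by rewrite !lt_min !divr_gt0// mulr_gt0.
have [eD [er e1]] : e <= eta / D /\ e <= (r - enorm (y - x)) / (2 * m) /\ e <= 1 / m.
  by rewrite /e !ge_min !lexx !orbT.
have [z [Oz yz]] := clOy _ (nbhsx_ballx y e e0).
have zy : enorm (z - y) <= m * e.
  apply: enorm_le_bound (ltW e0) _ => i; rewrite !mxE distrC.
  by apply: ltW; case: yz => _ /(_ 0 i).
have zye1 : m * e <= 1 by rewrite mulrC -ler_pdivlMr.
have xz : eball x r z.
  rewrite /eball /=; have -> : z - x = (z - y) + (y - x) by rewrite addrA subrK.
  apply: le_lt_trans (enorm_triangle _ _) _.
  have : m * e <= (r - enorm (y - x)) / 2.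
    rewrite mulrC -ler_pdivlMr//; apply: le_trans er _.
    by rewrite invfM mulrA.
  by lra.
have /ltW phiz := (graph xz).1 Oz.
have yc : cube (base y) (base y) by move=> i; rewrite subrr normr0.
have zc : cube (base y) (base z).
  by move=> i; apply: le_trans (base_dist z y i) _; apply: le_trans zye1.
have := phiL _ _ yc zc.
have : L * \sum_i `|base y 0 i - base z 0 i| <= L * (n%:R * (m * e)).
  apply: ler_wpM2l => //; rewrite mulr_natl -[in leRHS](card_ord n) -sumr_const.
  by apply: ler_sum => i _; rewrite distrC; apply: le_trans (base_dist z y i) zy.
have := le_trans (height_dist z y) zy.
have : m * e + L * (n%:R * (m * e)) <= eta.
  have -> : m * e + L * (n%:R * (m * e)) = e * D by rewrite /D; ring.
  by rewrite -ler_pdivlMr.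
rewrite /height /base in phiz *.
rewrite !ler_norml; lra.
Qed.

(** Cut the base of the graph into N ^ n cubes of side 2 / N. As phi is
    Lipschitz, the part of the graph above each of them has diameter at most a
    constant times 1 / N. *)
Lemma boundary_graph_hausdorff_lty : exists2 rho : R, 0 < rho &
  (@hausdorff_outer R n.+1 n (boundary Omega `&` ball x rho) < +oo)%E.
Proof.
pose m : R := n.+1%:R; have m0 : 0 < m by rewrite ltr0n.
have [L L0 phiL] := C1_lipschitz_cube (base x) phiC1.
pose rho := Num.min r 1 / (2 * m).
have rho0 : 0 < rho by rewrite divr_gt0 ?mulr_gt0// lt_min r0 ltr01.
exists rho => //; set E := _ `&` _.
have Ex y : E y -> eball x r y /\ enorm (y - x) < 1.
  move=> [_ [_ xy]].
  have : enorm (y - x) <= m * rho.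
    by apply: enorm_le_bound (ltW rho0) _ => i; rewrite !mxE distrC; exact/ltW/xy.
  have -> : m * rho = Num.min r 1 / 2 by rewrite /rho; field; rewrite gt_eqF.
  have : Num.min r 1 <= r by rewrite ge_min lexx.
  have : Num.min r 1 <= 1 by rewrite ge_min lexx orbT.
  move: (Num.min r 1) => a a1 ar yx.
  have a21 : a / 2 < 1 by lra.
  have r0' : 0 < r := r0.
  have a2r : a / 2 < r by lra.
  by split; [exact: le_lt_trans yx a2r|exact: le_lt_trans yx a21].
have Ebase y i : E y -> -1 < base y 0 i - base x 0 i < 1.
  by move=> /Ex[_ yx]; rewrite -ltr_norml; apply: le_lt_trans (base_dist y x i) yx.
have Eheight y : E y -> height y = phi (base y).
  by move=> Ey; have [? _] := Ex y Ey; case: Ey => [bdy _]; exact: boundary_graph.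
apply: (@hausdorff_outer_lty _ _ _ _ (m * ((L * n%:R + 1) * 2))).
  by rewrite mulr_ge0// mulr_ge0// addr_ge0// mulr_ge0.
move=> N N0; have N0' : 0 < N%:R :> R by rewrite ltr0n.
(* The integer part of slot y i numbers the subinterval that contains the i-th
   base coordinate of y. *)
pose slot y i := (base y 0 i - base x 0 i + 1) * N%:R / 2.
exists (fun k : {ffun 'I_n -> 'I_N} => [set y | E y /\ forall i, Num.truncn (slot y i) = k i]).
have slot0 y i : E y -> 0 <= slot y i.
  by move=> /(Ebase _ i)/andP[? _]; rewrite /slot divr_ge0// mulr_ge0//; lra.
split => [y Ey|k y z [Ey yk] [Ez zk]].
  have lt_slot i : (Num.truncn (slot y i) < N)%N.
    rewrite truncn_lt_nat ?slot0// /slot ltr_pdivrMr// mulrC ltr_pM2l//.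
    by have /(Ebase _ i) := Ey; lra.
  by exists [ffun i => Ordinal (lt_slot i)]; split => // i; rewrite ffunE.
have bb i : `|base y 0 i - base z 0 i| <= 2 / N%:R.
  have := truncn_itv (slot0 y i Ey); have := truncn_itv (slot0 z i Ez).
  rewrite yk zk -[(k i).+1%:R]natr1 /slot !ler_pdivlMr// !ltr_pdivrMr// => hz hy.
  rewrite -[N%:R in leLHS]ger0_norm// -normrM ler_norml; nra.
have hh : `|height y - height z| <= L * n%:R * (2 / N%:R).
  rewrite !Eheight//; apply: le_trans (phiL _ _ _ _) _.
  - by move=> i; rewrite ler_norml; have /(Ebase _ i) := Ey; lra.
  - by move=> i; rewrite ler_norml; have /(Ebase _ i) := Ez; lra.
  rewrite -mulrA; apply: ler_wpM2l => //.
  rewrite [leRHS]mulr_natl -[in leRHS](card_ord n) -sumr_const.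
  exact: ler_sum.
have N20 : 0 <= 2 / N%:R :> R by rewrite divr_ge0.
rewrite -(enorm_orthogonal _ QQ).
have -> : m * ((L * n%:R + 1) * 2) / N%:R = n.+1%:R * ((L * n%:R + 1) * (2 / N%:R)).
  by rewrite /m !mulrA.
move: (2 / N%:R) N20 bb hh => d d0 bb hh; have Ln0 : 0 <= L * n%:R by rewrite mulr_ge0.
apply: enorm_le_bound.
  by rewrite mulr_ge0// addr_ge0.
move=> j; rewrite mulmxBl; have [i|] := unliftP ord_max j => ->.
  apply: le_trans (_ : d <= _).
    by have := bb i; rewrite !mxE.
  by rewrite mulrDl mul1r lerDr mulr_ge0.
apply: le_trans (_ : L * n%:R * d <= _).
  by have := hh; rewrite /height !mxE.
by rewrite mulrDl mul1r lerDl.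
Qed.

End boundary_is_locally_a_graph.

(** Compactness of the boundary reduces the claim to finitely many graphs. *)
Lemma bounded_C2_domain_perimeter_lty (R : realType) n (Omega : set 'rV[R]_n.+1) :
  bounded_C2_domain Omega -> (@hausdorff_outer R n.+1 n (boundary Omega) < +oo)%E.
Proof.
move=> [Oopen _ _ [M [Mreal OM]] OC2].
have cptB : compact (boundary Omega).
  apply: bounded_closed_compact.
    exists (M + 1); split; first exact: realD.
    move=> M' MM' y [clOy _] /=.
    have [z [Oz]] := clOy _ (nbhsx_ballx y 1 ltr01).
    rewrite -ball_normE /= => /ltW yz.
    rewrite -(subrK z y); apply: le_trans (ler_normD _ _) _.
    rewrite -(subrK 1 M') addrC; apply: lerD yz.
    by apply: OM => //; rewrite ltrBrDr.
  rewrite /boundary setDE; apply: closedI; first exact: closed_closure.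
  by apply: open_closedC; exact: open_interior.
have /choice[rho rhoP] : forall x : 'rV[R]_n.+1, exists rho : R, boundary Omega x ->
    0 < rho /\ (@hausdorff_outer R n.+1 n (boundary Omega `&` ball x rho) < +oo)%E.
  move=> x; have [bx|nbx] := pselect (boundary Omega x); last by exists 0 => /nbx.
  have [r [Q [phi [r0 QQ [phiC1 _] graph]]]] := OC2 x bx.
  by have [rho] := boundary_graph_hausdorff_lty Oopen QQ phiC1 r0 graph; exists rho.
move: cptB; rewrite compact_cover => /(_ _ (boundary Omega) (fun x => interior (ball x (rho x)))).
case.
- by move=> x _; exact: open_interior.
- by move=> x bx; exists x => //; have [? _] := rhoP x bx; exact: nbhsx_ballx.
move=> D DB BD.
apply: (@outer_measure_finite_cover_lty R _ _ _ (finmap.enum_fset D)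
  (fun x => boundary Omega `&` ball x (rho x))).
  move=> y By; have [x xD xy] := BD y By; exists x => //.
  by split => //; exact: interior_subset xy.
by move=> x xD; have [] := rhoP x (set_mem (DB x xD)).
Qed.

(** * Energies and strong convergence *)

Section energies.
Context {R : realType} {n : nat}.
Variable Omega : set 'rV[R]_n.+1.
Variable gamma : ('rV[R]_n.+1 -> R) -> 'rV[R]_n.+1 -> R.
Hypothesis gammaP : trace_operator Omega gamma.
Hypothesis perimeter : (@hausdorff_outer R n.+1 n (boundary Omega) < +oo)%E.
Local Notation mu := (domain_measure Omega).
Local Notation sigma := (surface_measure Omega).
Local Notation X := (X_pair Omega).
Local Notation Y := (X_infty Omega).
Implicit Types (w : X) (y : Y).

(** An isometry of the limit space into each of the approximating spaces; it
    turns the energy E_infty into the restriction of E_pair. *)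
Definition extend_by_zero y : X := (y, 0).

Lemma sigma_fin : (sigma setT < +oo)%E.
Proof. by rewrite /surface_measure /= /surface_outer /restr_outer setTI. Qed.

Lemma sub_extend2 w y : (w - extend_by_zero y).2 = w.2.
Proof. exact: (subr0 w.2). Qed.

Lemma ip_infty_semi_inner : semi_inner (@ip_infty R n Omega).
Proof. exact: (L2ip_semi_inner mu). Qed.

Lemma ip_pairE (tau : R) w v :
  ip_pair tau w v = L2ip w.1 v.1 + tau * L2ip w.2 v.2.
Proof. by []. Qed.

Lemma ip_pair_semi_inner (tau : R) : 0 < tau -> semi_inner (@ip_pair R n Omega tau).
Proof.
move=> tau0; have [muC muL mu0] := L2ip_semi_inner mu.
have [sC sL s0] := L2ip_semi_inner sigma; split=> [w v|a w v z|w]; rewrite !ip_pairE.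
- by rewrite muC sC.
- by rewrite /= muL sL; ring.
- by rewrite addr_ge0 ?mulr_ge0 ?(ltW tau0).
Qed.

Lemma ip_pair_extend (tau : R) y w :
  ip_pair tau (extend_by_zero y) w = ip_infty y w.1.
Proof.
by rewrite ip_pairE (ip0l (L2ip_semi_inner sigma)) mulr0 addr0.
Qed.

Lemma extend_by_zero_isometry (tau : R) y :
  nrm (@ip_pair R n Omega tau) (extend_by_zero y) = nrm (@ip_infty R n Omega) y.
Proof. by rewrite /nrm ip_pair_extend. Qed.

Lemma extend_by_zero_linear a x y :
  extend_by_zero (a *: x + y) = a *: extend_by_zero x + extend_by_zero y.
Proof.
have E : a *: (0 : LfunType sigma (@le1_2 R)) + 0 = 0 by rewrite scaler0 addr0.
by rewrite /extend_by_zero -{1}E.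
Qed.

Lemma extend_by_zeroB x y : extend_by_zero (x - y) = extend_by_zero x - extend_by_zero y.
Proof. by rewrite addrC -scaleN1r extend_by_zero_linear scaleN1r addrC. Qed.

Lemma nrm_L_pair_le (tau : R) w : 0 < tau ->
  nrm (@ip_infty R n Omega) (L_pair w) <= nrm (@ip_pair R n Omega tau) w.
Proof.
move=> tau0; rewrite /nrm ler_wsqrtr// ip_pairE lerDl mulr_ge0 ?(ltW tau0)//.
by have [_ _] := L2ip_semi_inner sigma; exact.
Qed.

Lemma nrm_trace_le (tau : R) w : 0 < tau ->
  Num.sqrt tau * nrm (@L2ip _ _ _ sigma) w.2 <= nrm (@ip_pair R n Omega tau) w.
Proof.
move=> tau0; rewrite /nrm -sqrtrM ?(ltW tau0)// ler_wsqrtr// ip_pairE lerDr.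
by have [_ _] := L2ip_semi_inner mu; exact.
Qed.

Lemma total_variation_ge0 (w : 'rV[R]_n.+1 -> R) : (0 <= Defs.total_variation Omega w)%E.
Proof.
have E (i : 'I_n.+1) : (fun y : 'rV[R]_n.+1 => (0 : 'rV[R]_n.+1) 0 i) = cst 0.
  by apply/funext => y; rewrite mxE.
apply: ereal_sup_ubound; exists (fun=> 0).
  split; last by move=> x; rewrite enormE /nrm (ip0l dot_semi_inner) sqrtr0.
  split; last by exists set0; split => //; exact: compact0.
  move=> i; rewrite E => j; split; first by move=> x; exact: derivable_cst.
  rewrite (_ : partial j (cst 0) = cst 0); first exact: cst_continuous.
  by apply/funext => x; rewrite /partial derive_cst.
rewrite (_ : (fun x => _) = cst 0%E) ?integral0//.
apply/funext => x; rewrite /divergence big1 ?mulr0// => i _.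
by rewrite E /partial derive_cst.
Qed.

Lemma E_infty_ge0 y : (0 <= E_infty gamma y)%E.
Proof.
rewrite /E_infty; case: ifP => // _; rewrite adde_ge0 ?total_variation_ge0//.
by apply: integral_ge0 => x _; rewrite lee_fin.
Qed.

Lemma E_pair_ge0 w : (0 <= E_pair gamma w)%E.
Proof.
rewrite /E_pair; case: ifP => // _; rewrite adde_ge0 ?total_variation_ge0//.
by apply: integral_ge0 => x _; rewrite lee_fin.
Qed.

Lemma E_pair_extend y : E_pair gamma (extend_by_zero y) = E_infty gamma y.
Proof.
rewrite /E_pair /E_infty.
have -> : (extend_by_zero y).1 = y by [].
case: ifP => // _; congr (_ + _)%E; apply: eq_integral => x _.
have -> : (extend_by_zero y).2 x = 0 by exact: L2_zeroE.
by rewrite subr0.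
Qed.

(** The triangle inequality |gamma w.1| <= |gamma w.1 - w.2| + |w.2| on the
    boundary. *)
Lemma E_infty_le w :
  (E_infty gamma w.1 <= E_pair gamma w + (\int[sigma]_x `|w.2 x|)%:E)%E.
Proof.
rewrite /E_infty /E_pair; case: ifPn => [/asboolP bv|_]; last first.
  by rewrite addye//.
rewrite -addeA leeD2l//.
have [gL1 _] := gammaP bv.
pose bdry := caratheodory_type (surface_outer Omega).
have mg : measurable_fun [set: bdry] (gamma w.1 : bdry -> R).
  by move/Lfun1_integrable : gL1 => /integrableP[/measurable_EFinP].
exact: (integral_norm_le_sub sigma_fin w.2 mg).
Qed.

(** Test the subdifferential of E_pair at w with (y, 0) and the one of E_infty at
    y with w.1. When the two inequalities are added the energies cancel, up to
    the integral of |w.2| over the boundary, which the norm weighted by tau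
    controls with the factor 1 / sqrt tau. *)
Lemma subdifferential_cross (tau : R) w y g h : 0 < tau ->
  subdifferential (@ip_pair R n Omega tau) (E_pair gamma) w (- g) ->
  subdifferential (@ip_infty R n Omega) (E_infty gamma) y (- h) ->
  ip_pair tau (g - extend_by_zero h) (w - extend_by_zero y)
    <= (fine (sigma setT) + 1) / Num.sqrt tau
       * nrm (@ip_pair R n Omega tau) (w - extend_by_zero y).
Proof.
move=> tau0 [Ew dw] [Ey dy].
have P := ip_pair_semi_inner tau0; have Q := ip_infty_semi_inner.
have Ewf : E_pair gamma w \is a fin_num by rewrite ge0_fin_numE// E_pair_ge0.
have Eyf : E_infty gamma y \is a fin_num by rewrite ge0_fin_numE// E_infty_ge0.
have := dw (extend_by_zero y); rewrite E_pair_extend => {}dw.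
have {}dy := le_trans (dy w.1) (E_infty_le w).
rewrite -(fineK Ewf) -(fineK Eyf) -!EFinD !lee_fin in dw dy.
have qE : ip_infty (- h) (w.1 - y) = - ip_pair tau (extend_by_zero h) (w - extend_by_zero y).
  by rewrite ip_pair_extend (ipNl Q).
have [_ L1L2] := L1_le_L2 sigma_fin w.2.
have := nrm_trace_le (w - extend_by_zero y) tau0.
rewrite sub_extend2.
have st : 0 < Num.sqrt tau by rewrite sqrtr_gt0.
rewrite mulrC -ler_pdivlMr// => trace.
have A0 : 0 <= fine (sigma setT) + 1 by rewrite addr_ge0// fine_ge0.
have := le_trans L1L2 (ler_wpM2l A0 trace).
have pE : ip_pair tau (- g) (extend_by_zero y - w) = ip_pair tau g (w - extend_by_zero y).
  by rewrite -(opprB w) (ipNl P) (ipC P g) (ipNl P) opprK (ipC P).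
rewrite qE in dy; rewrite pE in dw.
rewrite (ipBl P); lra.
Qed.

End energies.

Section convergence.
Context {R : realType} {n : nat}.
Variable Omega : set 'rV[R]_n.+1.
Local Notation X := (X_pair Omega).
Local Notation Y := (X_infty Omega).
Local Notation nrmY := (nrm (@ip_infty R n Omega)).
Local Notation nrmX tau := (nrm (@ip_pair R n Omega tau)).

(** The square of the norm splits as |u1 - u0|^2 + (|u|_tau^2 - |u1|^2), the
    bracket being the boundary part; strong convergence sends both terms to
    zero. *)
Lemma strongly_converges_extend (u : R -> X) (u0 : Y) :
  strongly_converges (X := fun=> X) (@ip_pair R n Omega) (@ip_infty R n Omega)
    (fun=> @L_pair R n Omega) u u0 ->
  forall eps : R, 0 < eps -> \forall tau \near +oo,
    nrmX tau (u tau - extend_by_zero u0) <= eps.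
Proof.
move=> [uN uL] eps eps0.
have Q := @ip_infty_semi_inner R n Omega.
have u1N : nrmY (L_pair (u tau)) @[tau --> +oo] --> nrmY u0.
  apply/cvgrPdist_le => e e0; move/cvgrPdist_le : uL => /(_ _ e0).
  apply: filterS => tau; rewrite sub0r normrN ger0_norm ?nrm_ge0// => ?.
  by rewrite distrC; apply: le_trans (nrm_lipschitz Q _ _) _.
have lim0 : (nrmY (L_pair (u tau) - u0) ^+ 2 + (nrmX tau (u tau) ^+ 2 - nrmY (L_pair (u tau)) ^+ 2))
    @[tau --> +oo] --> (0 : R).
  rewrite (_ : 0 = 0 ^+ 2 + (nrmY u0 ^+ 2 - nrmY u0 ^+ 2)); last by rewrite subrr expr0n addr0.
  apply: cvgD; first exact: cvgM.
  by apply: cvgB; exact: cvgM.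
have eps20 : 0 < eps ^+ 2 by rewrite exprn_gt0.
move/cvgrPdist_le : lim0 => /(_ _ eps20) lim0.
near=> tau; have tau0 : 0 < tau by near: tau; exact: nbhs_pinfty_gt.
rewrite -(@ler_pXn2r _ 2) ?nnegrE ?nrm_ge0 ?(ltW eps0)//.
have P := ip_pair_semi_inner Omega tau0.
have -> : nrmX tau (u tau - extend_by_zero u0) ^+ 2 =
  nrmY (L_pair (u tau) - u0) ^+ 2 + (nrmX tau (u tau) ^+ 2 - nrmY (L_pair (u tau)) ^+ 2).
  rewrite (nrm_sqr P) !(nrm_sqr Q) (nrm_sqr P) !ip_pairE.
  rewrite sub_extend2.
  by rewrite /ip_infty /L2ip /L_pair /=; ring.
apply: le_trans (ler_norm _) _; rewrite -normrN -sub0r.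
by near: tau.
Unshelve. all: by end_near. Qed.

End convergence.

(** * Convergence of the flows *)

Theorem theorem6p4 (R : realType) (n : nat) (Omega : set 'rV[R]_n.+1)
    (gamma : ('rV[R]_n.+1 -> R) -> 'rV[R]_n.+1 -> R)
    (S : R -> X_pair Omega -> R -> X_pair Omega)
    (S_infty : X_infty Omega -> R -> X_infty Omega) :
  bounded_C2_domain Omega ->
  trace_operator Omega gamma ->
  (forall tau : R, 0 < tau ->
     gradient_flow (V := X_pair Omega) (@ip_pair R n Omega tau) (E_pair gamma) (S tau)) ->
  gradient_flow (V := X_infty Omega) (@ip_infty R n Omega) (E_infty gamma) S_infty ->
  flows_converge_uniformly
    (X := fun=> X_pair Omega) (Y := X_infty Omega)
    (@ip_pair R n Omega) (@ip_infty R n Omega) (fun=> @L_pair R n Omega)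
    (fun=> E_pair gamma) S (E_infty gamma) S_infty.
Proof.
move=> OC2 gammaP flow flow_infty T u u0 T0 du0 du ucv.
have perim := bounded_C2_domain_perimeter_lty OC2.
set K : R := fine (surface_measure Omega setT) + 1.
have K0 : 0 <= K by rewrite addr_ge0// fine_ge0.
have tT0 (t : R) : t \in `[0, T] -> 0 <= t <= T by rewrite in_itv.
have close eps : 0 < eps -> \forall tau \near +oo, 0 < tau /\ forall t, t \in `[0, T] ->
    nrm (@ip_pair R n Omega tau) (S tau (u tau) t - extend_by_zero (S_infty u0 t)) <= eps.
  move=> eps0; have eps20 : 0 < eps / 2 by rewrite divr_gt0.
  have initial := strongly_converges_extend ucv eps20.
  near=> tau; have tau0 : 0 < tau by near: tau; exact: nbhs_pinfty_gt.
  split => // t tT.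
  have KT : 2 * (K / Num.sqrt tau) * T <= eps / 2.
    have large : (4 * K * T / eps) ^+ 2 <= tau by near: tau; apply: nbhs_pinfty_ge; exact: num_real.
    have st : 0 < Num.sqrt tau by rewrite sqrtr_gt0.
    have : 4 * K * T / eps <= Num.sqrt tau.
      rewrite -[leLHS]ger0_norm ?divr_ge0 ?mulr_ge0 ?(ltW T0) ?(ltW eps0)//.
      by rewrite -sqrtr_sqr ler_wsqrtr.
    rewrite ler_pdivrMr// => large'.
    by rewrite mulrA mulrAC ler_pdivrMr//; lra.
  have P := ip_pair_semi_inner Omega tau0.
  have [cu u00 [g [ug dg]]] := flow tau tau0 (u tau) (du tau tau0) T T0.
  have [cy y00 [h [yh dh]]] := flow_infty u0 du0 T T0.
  have isom := @extend_by_zero_isometry R n Omega tau.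
  have lin := @extend_by_zero_linear R n Omega.
  have c0 : 0 <= K / Num.sqrt tau by rewrite divr_ge0// sqrtr_ge0.
  have dgh : {ae @lebesgue_measure R, forall t, t \in `]0, T[ ->
      ip_pair tau (g t - extend_by_zero (h t)) (S tau (u tau) t - extend_by_zero (S_infty u0 t)) <=
      K / Num.sqrt tau * nrm (@ip_pair R n Omega tau)
        (S tau (u tau) t - extend_by_zero (S_infty u0 t))}.
    move: dg dh; apply: filterS2; first exact: (ae_filter_ringOfSetsType (@lebesgue_measure R)).
    move=> s dg dh sT.
    exact: (subdifferential_cross gammaP perim tau0 (dg sT) (dh sT)).
  (* From the initial distance eps / 2 the flows can drift apart by at most
     another eps / 2. *)
  have := comparison_le P T0 cu (continuous_on_isometry lin isom cy) ug
    (W11loc_isometry lin isom yh) c0 dgh (tT0 t tT).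
  move=> /le_trans; apply.
  rewrite [leRHS](splitr eps); apply: lerD => //.
  apply: le_trans (nrm_dist_triangle P (u tau) _ _) _; rewrite u00 add0r.
  apply: le_trans (nrm_dist_triangle P (extend_by_zero u0) _ _) _.
  have -> : nrm (@ip_pair R n Omega tau) (extend_by_zero u0 - extend_by_zero (S_infty u0 0)) = 0.
    by rewrite -extend_by_zeroB extend_by_zero_isometry
      (nrm_distC (@ip_infty_semi_inner R n Omega)).
  by rewrite addr0; near: tau.
split=> eps eps0; have := close eps eps0; apply: filterS => tau [tau0 le_eps] t tT.
  apply: le_trans (le_eps t tT).
  exact: (nrm_L_pair_le (S tau (u tau) t - extend_by_zero (S_infty u0 t)) tau0).
rewrite -(extend_by_zero_isometry tau).
apply: le_trans (le_eps t tT); exact: (nrm_lipschitz (ip_pair_semi_inner Omega tau0)).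
Unshelve. all: by end_near. Qed.
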